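(* Let $n,m$ be positive integers with $n+2\le 2m+1<2n+1$, and let $a:\mathbb{R}\to\mathbb{R}$ be an arbitrary positive smooth periodic function. Then there exists a continuous non-positive periodic function $p:\mathbb{R}\to\mathbb{R}$ such that the equation $$x''+a(x)\,x^{2n+1}+p(t)\,x^{2m+1}=0$$ possesses a solution which escapes to infinity in some finite time, and the trivial solution $x=0$ is not stable.
   Context: Here $x=x(t)$ is a real-valued unknown function and primes denote $d/dt$. A solution escapes to infinity in finite time (blows up) if it is defined on some interval $[t_0,T)$ with $T<+\infty$ and $|x(t)|+|x'(t)|\to+\infty$ as $t\to T^-$. Stability of the trivial solution is in the Liapunov sense. *)

(* Defs.v *)
From Stdlib Require Import Reals.
From Coquelicot Require Import Coquelicot.
Open Scope R_scope.

Definition periodic (f : R -> R) : Prop :=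
  exists P : R, 0 < P /\ forall x : R, f (x + P) = f x.

Definition smooth (f : R -> R) : Prop :=
  forall (k : nat) (x : R), ex_derive_n f k x.

(* [x] solves x'' + F(t, x) = 0 on [t0, T).  The derivatives at [t0] are
   two-sided; this costs no generality, since the values of [x] to the left of
   [t0] are otherwise unconstrained and a one-sided solution extends to t < t0
   by its second-order Taylor polynomial at [t0]. *)
Definition solution_on (F : R -> R -> R) (t0 : R) (T : Rbar) (x : R -> R)
  : Prop :=
  forall t : R, t0 <= t -> Rbar_lt t T ->
    ex_derive x t /\ ex_derive_n x 2 t /\ Derive_n x 2 t + F t (x t) = 0.

Definition blows_up (F : R -> R -> R) (t0 T : R) (x : R -> R) : Prop :=
  t0 < T /\ solution_on F t0 T x /\
  filterlim (fun t => Rabs (x t) + Rabs (Derive x t))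
    (at_left T) (Rbar_locally p_infty).

(* Liapunov stability of x = 0: motions starting close to (0, 0) exist for all
   t >= t0, and every solution with such initial data stays close to (0, 0) on
   any interval [t0, T) on which it is defined. *)
Definition zero_stable (F : R -> R -> R) : Prop :=
  forall t0 eps : R, 0 < eps ->
  exists delta : R, 0 < delta /\
  forall x0 v0 : R, Rabs x0 + Rabs v0 < delta ->
    (exists x : R -> R,
       solution_on F t0 p_infty x /\ x t0 = x0 /\ Derive x t0 = v0) /\
    (forall (T : Rbar) (x : R -> R),
       solution_on F t0 T x -> x t0 = x0 -> Derive x t0 = v0 ->
       forall t : R, t0 <= t -> Rbar_lt t T ->
         Rabs (x t) + Rabs (Derive x t) < eps).

(* Main.v *)
(* Idea.  Look for p in the feedback form p(t) = - 1 - q(x(t), x'(t)) along a single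
   solution x.  With g(x) = a(x) x^(2n+1) - x^(2m+1), G' = g and E = v^2/2 + G(x), put
     q = gain x^(2(n-m)+1) v E^(kappa-1),  kappa = 1/(4n+4),
   so that E' = q x^(2m+1) v is proportional to E^(kappa-1) x^(2n+2) v^2 >= 0.  On the
   energy level E one has |x| <~ E^(1/(2n+2)) and |v| <~ E^(1/2), and the hypothesis
   n + 2 <= 2m + 1 is what makes q <~ E^(-kappa).  The bounded function
     - E^(-kappa) + mu (x v / E - K x^(2n+3) v / E^2)
   has derivative bounded below by a positive constant for large E: the bracket replaces
   the degenerate gain at x = 0 and at v = 0 by a uniform one.  Hence E becomes infinite
   in a finite time T, where q tends to 0; starting from x = 0, where q = 0, the profile
   q extends to a continuous T-periodic function with |q| <= 1/2.

   Since p <= -1/2 and m < n, the term p x^(2m+1) dominates near x = 0 and repels from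
   the origin, whence the instability. *)
Require Import Defs.
From Stdlib Require Import Reals Lra Lia Psatz ZArith.
From Coquelicot Require Import Coquelicot.
Open Scope R_scope.

(** * Monotonicity and the Picard iteration *)

(** The feedback makes the problem autonomous: the field $(v,\,-g(x)+q\,x^{2m+1})$ depends on
    $(x,v)$ alone, so the curve precedes $p$, which is read off it. The field is only locally
    Lipschitz and the wanted solution is not global; divided by a power of $1+|x|+|v|$ it becomes
    bounded and Lipschitz, hence has a global flow, and the blow-up time is the supremum of the
    original time along that flow.

    Write $w=x^{2n+2}/E$, $s=v^2/E$, $X=xg/E$. Since $E'$ is proportional to $E^{1+\kappa}ws$, a
    positive $\kappa$ gives superlinear growth, while $q=O(E^{-\kappa})$ asks for
    $2\kappa\le(2m-n)/(2n+2)$; $1/(4n+4)$ is the value that suits every $2m-n\ge1$.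

    The bracket comes from the virial identity: up to feedback terms $xv/E$ has derivative $s-X$,
    which is negative where potential energy dominates. The factor $1-Kw$ changes this into
    $s-(1-Kw)X$, where $X$ has the good sign for large $w$, at the cost of $K(2n+3)ws$. That cost
    has the same shape as the gain, so a small $\mu$ absorbs it, and no period or amplitude of the
    oscillation has to be computed. *)

Lemma is_derive_continuous (f : R -> R) (x d : R) : is_derive f x d -> continuous f x.
Proof. intros H. apply (ex_derive_continuous (V := R_NormedModule)). exists d; exact H. Qed.

Lemma is_derive_continuity_pt (f : R -> R) (x d : R) : is_derive f x d -> continuity_pt f x.
Proof. intros H. apply continuity_pt_filterlim. eapply is_derive_continuous, H. Qed.

Lemma derive_nonneg_le (f df : R -> R) (a b : R) :
  a <= b ->
  (forall x, a <= x <= b -> is_derive f x (df x)) ->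
  (forall x, a <= x <= b -> 0 <= df x) ->
  f a <= f b.
Proof.
  intros Hab Hd Hp.
  destruct (MVT_gen f a b df) as [c [Hc Heq]].
  - intros x Hx. rewrite Rmin_left, Rmax_right in Hx by lra. apply Hd; lra.
  - intros x Hx. rewrite Rmin_left, Rmax_right in Hx by lra.
    apply is_derive_continuity_pt with (df x), Hd; lra.
  - rewrite Rmin_left, Rmax_right in Hc by lra.
    specialize (Hp c Hc).
    assert (0 <= df c * (b - a)) by (apply Rmult_le_pos; lra). lra.
Qed.

Lemma ex_derive_nonneg_le (f : R -> R) (a b : R) :
  a <= b ->
  (forall x, a <= x <= b -> exists d, is_derive f x d /\ 0 <= d) ->
  f a <= f b.
Proof.
  intros Hab H. apply (derive_nonneg_le f (Derive f)); auto; intros x Hx;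
    destruct (H x Hx) as (d & Hd & Hpos).
  - apply Derive_correct. exists d; exact Hd.
  - rewrite (is_derive_unique f x d Hd). exact Hpos.
Qed.

Lemma derive_dominated (f g df dg : R -> R) (a b : R) :
  a <= b ->
  (forall x, a <= x <= b -> is_derive f x (df x)) ->
  (forall x, a <= x <= b -> is_derive g x (dg x)) ->
  (forall x, a <= x <= b -> Rabs (df x) <= dg x) ->
  Rabs (f b - f a) <= g b - g a.
Proof.
  intros Hab Hf Hg Hle.
  assert (H1 : g a - f a <= g b - f b).
  { apply (derive_nonneg_le (fun x => g x - f x) (fun x => dg x - df x)); auto.
    - intros x Hx. apply (is_derive_minus g f); auto.
    - intros x Hx. specialize (Hle x Hx). apply Rabs_le_between in Hle. lra. }
  assert (H2 : g a + f a <= g b + f b).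
  { apply (derive_nonneg_le (fun x => g x + f x) (fun x => dg x + df x)); auto.
    - intros x Hx. apply (is_derive_plus g f); auto.
    - intros x Hx. specialize (Hle x Hx). apply Rabs_le_between in Hle. lra. }
  apply Rabs_le; lra.
Qed.

Lemma lipschitz_continuous (f : R -> R) (M : R) :
  (forall s t, Rabs (f t - f s) <= M * Rabs (t - s)) ->
  forall t, continuous f t.
Proof.
  intros H t. apply continuity_pt_filterlim. intros eps Heps.
  assert (HM : 0 <= M).
  { specialize (H 0 1). replace (1 - 0) with 1 in H by ring.
    rewrite Rabs_R1 in H. pose proof (Rabs_pos (f 1 - f 0)). lra. }
  exists (eps / (M + 1)). split.
  - apply Rdiv_lt_0_compat; lra.
  - intros s [_ Hs]. simpl in *. unfold R_dist in *.
    apply Rle_lt_trans with (1 := H t s).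
    apply Rle_lt_trans with ((M + 1) * Rabs (s - t)).
    + pose proof (Rabs_pos (s - t)). nra.
    + apply Rmult_lt_compat_l with (r := M + 1) in Hs; [|lra].
      replace ((M + 1) * (eps / (M + 1))) with eps in Hs by (field; lra). exact Hs.
Qed.

(** Telescoping leaves the tail of a geometric series. The explicit rate is kept because later
    identities are proved up to an error $O(2^{-k})$ at a fixed time. *)
Lemma geometric_limit (u : nat -> R) (A : R) :
  (forall k, Rabs (u (S k) - u k) <= A * (1 / 2) ^ k) ->
  forall k, Rabs (real (Lim_seq u) - u k) <= 2 * A * (1 / 2) ^ k.
Proof.
  intros Hu.
  assert (HA : 0 <= A).
  { specialize (Hu O). simpl in Hu. pose proof (Rabs_pos (u 1%nat - u 0%nat)). lra. }
  assert (Htail : forall k j,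
    Rabs (u (j + k)%nat - u k) <= 2 * A * ((1 / 2) ^ k - (1 / 2) ^ (j + k))).
  { intros k j; induction j as [|j IH]; simpl.
    - rewrite !Rminus_diag, Rabs_R0. lra.
    - specialize (Hu (j + k)%nat).
      replace (u (S (j + k)) - u k)
        with ((u (S (j + k)) - u (j + k)%nat) + (u (j + k)%nat - u k)) by ring.
      eapply Rle_trans; [apply Rabs_triang|]. lra. }
  assert (Hpos : forall i, 0 < (1 / 2) ^ i) by (intro; apply pow_lt; lra).
  assert (Htail' : forall k j, (k <= j)%nat ->
    Rabs (u j - u k) <= 2 * A * (1 / 2) ^ k).
  { intros k j Hkj. specialize (Htail k (j - k)%nat).
    replace (j - k + k)%nat with j in Htail by lia.
    specialize (Hpos j). nra. }
  assert (Hex : ex_finite_lim_seq u).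
  { apply ex_lim_seq_cauchy_corr. intros eps.
    destruct (pow_lt_1_zero (1 / 2)) with (y := eps / (4 * A + 1)) as [N HN].
    - rewrite Rabs_right; lra.
    - apply Rdiv_lt_0_compat; [apply cond_pos|lra].
    - exists N. intros p q Hp Hq.
      specialize (HN N (le_n N)).
      rewrite Rabs_right in HN by (apply Rle_ge, Rlt_le, Hpos).
      apply Rmult_lt_compat_l with (r := 4 * A + 1) in HN; [|lra].
      replace ((4 * A + 1) * (eps / (4 * A + 1))) with (pos eps) in HN by (field; lra).
      pose proof (Htail' N p Hp) as H1. pose proof (Htail' N q Hq) as H2.
      replace (u p - u q) with ((u p - u N) - (u q - u N)) by ring.
      eapply Rle_lt_trans; [apply Rabs_triang|]. rewrite Rabs_Ropp.
      specialize (Hpos N). nra. }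
  intros k.
  assert (Hl : is_lim_seq (fun j => Rabs (u j - u k)) (Rabs (real (Lim_seq u) - u k))).
  { apply (is_lim_seq_abs _ (Finite _)).
    apply (is_lim_seq_minus' u (fun _ => u k)).
    - apply Lim_seq_correct', Hex.
    - apply is_lim_seq_const. }
  refine (is_lim_seq_le_loc _ _ _ _ _ Hl (is_lim_seq_const (2 * A * (1 / 2) ^ k))).
  exists k. intros j Hj. apply Htail'; exact Hj.
Qed.

Section Picard.

Variables (F1 F2 : R -> R -> R) (L M x0 v0 : R).
Hypothesis L_pos : 0 < L.
Hypothesis F1_bnd : forall x v, Rabs (F1 x v) <= M.
Hypothesis F2_bnd : forall x v, Rabs (F2 x v) <= M.
Hypothesis F1_lip : forall x v x' v',
  Rabs (F1 x' v' - F1 x v) <= L * (Rabs (x' - x) + Rabs (v' - v)).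
Hypothesis F2_lip : forall x v x' v',
  Rabs (F2 x' v' - F2 x v) <= L * (Rabs (x' - x) + Rabs (v' - v)).

Lemma lipschitz_comp_continuous (F : R -> R -> R) (x v : R -> R) (t : R) :
  (forall x v x' v',
     Rabs (F x' v' - F x v) <= L * (Rabs (x' - x) + Rabs (v' - v))) ->
  continuous x t -> continuous v t -> continuous (fun s => F (x s) (v s)) t.
Proof.
  intros HF Hx Hv.
  apply (continuous_comp_2 x v F); auto.
  apply filterlim_locally. intros eps.
  assert (He : 0 < eps / (2 * L)) by (apply Rdiv_lt_0_compat; [apply cond_pos|lra]).
  exists (mkposreal _ He). intros [x' v'] [H1 H2].
  unfold ball in *; simpl in *; unfold AbsRing_ball, abs, minus, plus, opp in *; simpl in *.
  eapply Rle_lt_trans; [apply HF|].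
  apply Rlt_le_trans with (L * (eps / (2 * L) + eps / (2 * L))).
  - apply Rmult_lt_compat_l; auto. apply Rplus_lt_compat; assumption.
  - right; field; lra.
Qed.

(** One component of the Picard operator, with base time 0. *)
Definition integral_curve (F : R -> R -> R) (c : R) (x v : R -> R) (t : R) : R :=
  c + RInt (fun s => F (x s) (v s)) 0 t.

Lemma integral_curve_derive F c x v :
  (forall x v x' v',
     Rabs (F x' v' - F x v) <= L * (Rabs (x' - x) + Rabs (v' - v))) ->
  (forall t, continuous x t) -> (forall t, continuous v t) ->
  forall t, is_derive (integral_curve F c x v) t (F (x t) (v t)).
Proof.
  intros HF Hx Hv t.
  assert (Hc : forall s, continuous (fun s => F (x s) (v s)) s)
    by (intro; apply lipschitz_comp_continuous; auto).
  unfold integral_curve.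
  rewrite <- (Rplus_0_l (F (x t) (v t))).
  apply (is_derive_plus (fun _ => c)); [apply (is_derive_const c)|].
  apply (is_derive_RInt (fun s => F (x s) (v s)) _ 0).
  - apply filter_forall. intros b.
    apply (RInt_correct (V := R_CompleteNormedModule)).
    apply (ex_RInt_continuous (V := R_CompleteNormedModule)). intros; apply Hc.
  - apply Hc.
Qed.

Lemma integral_curve_0 F c x v : integral_curve F c x v 0 = c.
Proof. unfold integral_curve. rewrite RInt_point. unfold zero; simpl. ring. Qed.

Fixpoint picard (k : nat) : (R -> R) * (R -> R) :=
  match k with
  | O => (fun _ => x0, fun _ => v0)
  | S k => (integral_curve F1 x0 (fst (picard k)) (snd (picard k)),
            integral_curve F2 v0 (fst (picard k)) (snd (picard k)))
  end.

Lemma picard_continuous k :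
  (forall t, continuous (fst (picard k)) t) /\
  (forall t, continuous (snd (picard k)) t).
Proof.
  induction k as [|k [IH1 IH2]]; simpl.
  - split; intro; apply continuous_const.
  - split; intro t; eapply is_derive_continuous, integral_curve_derive; auto.
Qed.

Lemma picard_derive k t :
  is_derive (fst (picard (S k))) t (F1 (fst (picard k) t) (snd (picard k) t)) /\
  is_derive (snd (picard (S k))) t (F2 (fst (picard k) t) (snd (picard k) t)).
Proof.
  destruct (picard_continuous k). split; apply integral_curve_derive; auto.
Qed.

Lemma M_nonneg : 0 <= M.
Proof. eapply Rle_trans; [apply Rabs_pos|apply (F1_bnd 0 0)]. Qed.

Lemma derive_exp_scal (c t : R) :
  is_derive (fun s => c / (4 * L) * exp (4 * L * s)) t (c * exp (4 * L * t)).
Proof. auto_derive; [trivial|]. field; lra. Qed.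

(* The weight [exp (4 * L * t)] turns the Picard operator into a contraction of
   ratio 1/2 on the whole half-line. *)
Lemma integral_curve_contract F c x v x' v' A t :
  (forall x v x' v',
     Rabs (F x' v' - F x v) <= L * (Rabs (x' - x) + Rabs (v' - v))) ->
  (forall t, continuous x t) -> (forall t, continuous v t) ->
  (forall t, continuous x' t) -> (forall t, continuous v' t) ->
  0 <= A -> 0 <= t ->
  (forall s, 0 <= s -> Rabs (x' s - x s) + Rabs (v' s - v s) <= A * exp (4 * L * s)) ->
  Rabs (integral_curve F c x' v' t - integral_curve F c x v t)
    <= A / 4 * exp (4 * L * t).
Proof.
  intros HF Hx Hv Hx' Hv' HA Ht HD.
  pose proof (derive_dominated
    (fun s => integral_curve F c x' v' s - integral_curve F c x v s)
    (fun s => (L * A) / (4 * L) * exp (4 * L * s))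
    (fun s => F (x' s) (v' s) - F (x s) (v s))
    (fun s => L * A * exp (4 * L * s)) 0 t Ht) as H.
  cbv beta in H. rewrite !integral_curve_0, Rmult_0_r, exp_0 in H.
  replace (L * A / (4 * L)) with (A / 4) in H by (field; lra).
  replace (integral_curve F c x' v' t - integral_curve F c x v t)
    with (integral_curve F c x' v' t - integral_curve F c x v t - (c - c)) by ring.
  eapply Rle_trans; [apply H|].
  - intros s _. apply (is_derive_minus (integral_curve F c x' v'));
      apply integral_curve_derive; auto.
  - intros s _. replace (A / 4) with ((L * A) / (4 * L)) by (field; lra).
    apply derive_exp_scal.
  - intros s Hs. eapply Rle_trans; [apply HF|]. rewrite Rmult_assoc.
    apply Rmult_le_compat_l; [lra|]. apply HD; lra.
  - lra.
Qed.

(** With the weight of exponent [4 * L] each of the two components contracts by 1/4, whence the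
    ratio 1/2. The constant [M / (2 * L)] collects two primitives [M / (4 * L)] that dominate the
    first increment. *)
Lemma picard_step k t : 0 <= t ->
  Rabs (fst (picard (S k)) t - fst (picard k) t)
  + Rabs (snd (picard (S k)) t - snd (picard k) t)
  <= (M / (2 * L) * exp (4 * L * t)) * (1 / 2) ^ k.
Proof.
  pose proof M_nonneg as HM.
  revert t; induction k as [|k IH]; intros t Ht.
  - assert (Hexp : forall s, 0 <= s -> 1 <= exp (4 * L * s)).
    { intros s Hs. pose proof (exp_ineq1_le (4 * L * s)).
      assert (0 <= 4 * L * s) by (apply Rmult_le_pos; lra). lra. }
    assert (Hgen : forall F c, (forall x v, Rabs (F x v) <= M) ->
      (forall x v x' v',
        Rabs (F x' v' - F x v) <= L * (Rabs (x' - x) + Rabs (v' - v))) ->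
      Rabs (integral_curve F c (fun _ => x0) (fun _ => v0) t - c)
        <= M / (4 * L) * exp (4 * L * t)).
    { intros F c HB HF.
      pose proof (derive_dominated
        (integral_curve F c (fun _ => x0) (fun _ => v0))
        (fun s => M / (4 * L) * exp (4 * L * s))
        (fun s => F x0 v0) (fun s => M * exp (4 * L * s)) 0 t Ht) as H.
      cbv beta in H. rewrite integral_curve_0, Rmult_0_r, exp_0 in H.
      eapply Rle_trans; [apply H|].
      - intros s _. apply (integral_curve_derive F c (fun _ => x0) (fun _ => v0)); auto;
          intro; apply continuous_const.
      - intros s _. apply derive_exp_scal.
      - intros s Hs. eapply Rle_trans; [apply HB|].
        specialize (Hexp s (proj1 Hs)). nra.
      - assert (0 <= M / (4 * L)) by (apply Rdiv_le_0_compat; lra). lra. }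
    pose proof (Hgen F1 x0 F1_bnd F1_lip). pose proof (Hgen F2 v0 F2_bnd F2_lip).
    simpl. replace (M / (2 * L)) with (M / (4 * L) + M / (4 * L)) by (field; lra).
    lra.
  - destruct (picard_continuous k) as [C1 C2].
    destruct (picard_continuous (S k)) as [C3 C4].
    set (A := M / (2 * L) * (1 / 2) ^ k).
    assert (HA : 0 <= A).
    { apply Rmult_le_pos; [apply Rdiv_le_0_compat; lra|apply pow_le; lra]. }
    assert (HD : forall s, 0 <= s ->
      Rabs (fst (picard (S k)) s - fst (picard k) s)
      + Rabs (snd (picard (S k)) s - snd (picard k) s) <= A * exp (4 * L * s)).
    { intros s Hs. specialize (IH s Hs). unfold A. lra. }
    pose proof (integral_curve_contract F1 x0 _ _ _ _ A t F1_lip C1 C2 C3 C4 HA Ht HD).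
    pose proof (integral_curve_contract F2 v0 _ _ _ _ A t F2_lip C1 C2 C3 C4 HA Ht HD).
    change (Rabs (integral_curve F1 x0 (fst (picard (S k))) (snd (picard (S k))) t
                  - integral_curve F1 x0 (fst (picard k)) (snd (picard k)) t)
          + Rabs (integral_curve F2 v0 (fst (picard (S k))) (snd (picard (S k))) t
                  - integral_curve F2 v0 (fst (picard k)) (snd (picard k)) t)
          <= M / (2 * L) * exp (4 * L * t) * ((1 / 2) * (1 / 2) ^ k)).
    unfold A in *. lra.
Qed.

Lemma picard_lipschitz k s t :
  Rabs (fst (picard k) t - fst (picard k) s) <= M * Rabs (t - s) /\
  Rabs (snd (picard k) t - snd (picard k) s) <= M * Rabs (t - s).
Proof.
  pose proof M_nonneg as HM.
  assert (Hgen : forall (f df : R -> R),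
    (forall t, is_derive f t (df t)) -> (forall t, Rabs (df t) <= M) ->
    Rabs (f t - f s) <= M * Rabs (t - s)).
  { intros f df Hf Hb.
    assert (Hlin : forall x, is_derive (fun y => M * y) x M)
      by (intro; auto_derive; [trivial|ring]).
    destruct (Rle_dec s t) as [Hst|Hst].
    - rewrite (Rabs_right (t - s)) by lra.
      pose proof (derive_dominated f (fun y => M * y) df (fun _ => M) s t Hst) as H.
      cbv beta in H. rewrite Rmult_minus_distr_l. apply H; auto.
    - rewrite Rabs_minus_sym, (Rabs_minus_sym t s), (Rabs_right (s - t)) by lra.
      pose proof (derive_dominated f (fun y => M * y) df (fun _ => M) t s) as H.
      cbv beta in H. rewrite Rmult_minus_distr_l. apply H; auto; lra. }
  destruct k as [|k].
  - simpl. rewrite !Rminus_diag, Rabs_R0.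
    pose proof (Rabs_pos (t - s)). split; nra.
  - split.
    + apply (Hgen _ (fun t => F1 (fst (picard k) t) (snd (picard k) t))); auto.
      intro; apply picard_derive.
    + apply (Hgen _ (fun t => F2 (fst (picard k) t) (snd (picard k) t))); auto.
      intro; apply picard_derive.
Qed.

(** The Lipschitz constant does not depend on [k], so it survives a merely pointwise limit.
    [Rabs t], itself 1-Lipschitz in [t], restricts the limit to the times where the geometric
    estimate is available. *)
Lemma lim_lipschitz (u : nat -> R -> R) (A : R -> R) :
  (forall k t, 0 <= t -> Rabs (u (S k) t - u k t) <= A t * (1 / 2) ^ k) ->
  (forall k s t, Rabs (u k t - u k s) <= M * Rabs (t - s)) ->
  forall s t, Rabs (real (Lim_seq (fun k => u k (Rabs t)))
                    - real (Lim_seq (fun k => u k (Rabs s)))) <= M * Rabs (t - s).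
Proof.
  intros Hu Hl s t.
  pose proof (geometric_limit (fun k => u k (Rabs t)) _
    (fun k => Hu k _ (Rabs_pos t))) as H1.
  pose proof (geometric_limit (fun k => u k (Rabs s)) _
    (fun k => Hu k _ (Rabs_pos s))) as H2.
  cbv beta in H1, H2.
  set (a := real (Lim_seq (fun k => u k (Rabs t)))) in *.
  set (b := real (Lim_seq (fun k => u k (Rabs s)))) in *.
  assert (Hkey : forall k, Rabs (a - b) - M * Rabs (t - s)
    <= (2 * A (Rabs t) + 2 * A (Rabs s)) * (1 / 2) ^ k).
  { intros k. specialize (H1 k). specialize (H2 k).
    specialize (Hl k (Rabs s) (Rabs t)).
    pose proof M_nonneg.
    assert (M * Rabs (Rabs t - Rabs s) <= M * Rabs (t - s)).
    { apply Rmult_le_compat_l; auto. apply Rabs_triang_inv2. }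
    replace (a - b) with ((a - u k (Rabs t)) + (u k (Rabs t) - u k (Rabs s))
                          + (u k (Rabs s) - b)) by ring.
    pose proof (Rabs_triang ((a - u k (Rabs t)) + (u k (Rabs t) - u k (Rabs s)))
                          (u k (Rabs s) - b)).
    pose proof (Rabs_triang (a - u k (Rabs t)) (u k (Rabs t) - u k (Rabs s))).
    rewrite (Rabs_minus_sym (u k (Rabs s)) b) in *. lra. }
  assert (Hlim : is_lim_seq (fun k => (2 * A (Rabs t) + 2 * A (Rabs s)) * (1 / 2) ^ k) 0).
  { rewrite <- (Rmult_0_r (2 * A (Rabs t) + 2 * A (Rabs s))).
    apply (is_lim_seq_scal_l _ _ (Finite 0)), is_lim_seq_geom.
    rewrite Rabs_right; lra. }
  pose proof (is_lim_seq_le _ _ _ _ Hkey (is_lim_seq_const _) Hlim) as H. simpl in H. lra.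
Qed.

Lemma le_geometric_0 (c A : R) : (forall k, c <= A * (1 / 2) ^ k) -> c <= 0.
Proof.
  intros H.
  assert (Hlim : is_lim_seq (fun k => A * (1 / 2) ^ k) 0).
  { rewrite <- (Rmult_0_r A).
    apply (is_lim_seq_scal_l _ _ (Finite 0)), is_lim_seq_geom.
    rewrite Rabs_right; lra. }
  exact (is_lim_seq_le _ _ _ _ H (is_lim_seq_const _) Hlim).
Qed.

(* Only forward time is estimated: evaluating the field at [Rabs t] keeps two-sided
   derivatives everywhere without a separate argument for [t < 0]. *)
Theorem picard_lindelof :
  exists x v : R -> R, x 0 = x0 /\ v 0 = v0 /\
    (forall t, is_derive x t (F1 (x (Rabs t)) (v (Rabs t)))) /\
    (forall t, is_derive v t (F2 (x (Rabs t)) (v (Rabs t)))).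
Proof.
  set (A := fun t => M / (2 * L) * exp (4 * L * t)).
  assert (S1 : forall k t, 0 <= t ->
    Rabs (fst (picard (S k)) t - fst (picard k) t) <= A t * (1 / 2) ^ k).
  { intros k t Ht. pose proof (picard_step k t Ht).
    pose proof (Rabs_pos (snd (picard (S k)) t - snd (picard k) t)). unfold A; lra. }
  assert (S2 : forall k t, 0 <= t ->
    Rabs (snd (picard (S k)) t - snd (picard k) t) <= A t * (1 / 2) ^ k).
  { intros k t Ht. pose proof (picard_step k t Ht).
    pose proof (Rabs_pos (fst (picard (S k)) t - fst (picard k) t)). unfold A; lra. }
  set (x := fun t => real (Lim_seq (fun k => fst (picard k) (Rabs t)))).
  set (v := fun t => real (Lim_seq (fun k => snd (picard k) (Rabs t)))).
  assert (Cx : forall t, continuous x t).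
  { apply (lipschitz_continuous x M).
    apply (lim_lipschitz (fun k => fst (picard k)) A S1).
    intros; apply picard_lipschitz. }
  assert (Cv : forall t, continuous v t).
  { apply (lipschitz_continuous v M).
    apply (lim_lipschitz (fun k => snd (picard k)) A S2).
    intros; apply picard_lipschitz. }
  assert (Lx : forall k t, 0 <= t ->
    Rabs (x t - fst (picard k) t) <= 2 * A t * (1 / 2) ^ k).
  { intros k t Ht. unfold x. rewrite (Rabs_right t) by lra.
    apply (geometric_limit (fun k => fst (picard k) t)). auto. }
  assert (Lv : forall k t, 0 <= t ->
    Rabs (v t - snd (picard k) t) <= 2 * A t * (1 / 2) ^ k).
  { intros k t Ht. unfold v. rewrite (Rabs_right t) by lra.
    apply (geometric_limit (fun k => snd (picard k) t)). auto. }
  assert (HA : 0 <= M / (2 * L)) by (apply Rdiv_le_0_compat; [apply M_nonneg|lra]).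
  assert (Hsum : forall k s, 0 <= s ->
    Rabs (x s - fst (picard k) s) + Rabs (v s - snd (picard k) s)
      <= (4 * (M / (2 * L)) * (1 / 2) ^ k) * exp (4 * L * s)).
  { intros k s Hs. pose proof (Lx k s Hs). pose proof (Lv k s Hs). unfold A in *. lra. }
  assert (Hp : forall k, 0 <= 4 * (M / (2 * L)) * (1 / 2) ^ k).
  { intros k. apply Rmult_le_pos; [lra|apply pow_le; lra]. }
  (* Both sides are within a geometric error of the iterate [S k], for every [k]: the left by
     contraction, the right by convergence. *)
  assert (Efix : forall F c (p : nat -> R -> R) (y : R -> R),
    (forall x v x' v',
        Rabs (F x' v' - F x v) <= L * (Rabs (x' - x) + Rabs (v' - v))) ->
    (forall k t, p (S k) t
        = integral_curve F c (fst (picard k)) (snd (picard k)) t) ->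
    (forall k t, 0 <= t -> Rabs (y t - p k t) <= 2 * A t * (1 / 2) ^ k) ->
    forall t, 0 <= t -> integral_curve F c x v t = y t).
  { intros F c p y HF Hpk Hy t Ht.
    assert (Rabs (integral_curve F c x v t - y t) <= 0).
    { apply (le_geometric_0 _ (2 * A t)). intros k.
      pose proof (Hy (S k) t Ht) as H1. rewrite Hpk in H1. simpl in H1.
      destruct (picard_continuous k) as [C1 C2].
      pose proof (integral_curve_contract F c _ _ _ _ _ t HF C1 C2 Cx Cv (Hp k) Ht
        (Hsum k)) as H2.
      replace (integral_curve F c x v t - y t)
        with ((integral_curve F c x v t
               - integral_curve F c (fst (picard k)) (snd (picard k)) t)
              - (y t - integral_curve F c (fst (picard k)) (snd (picard k)) t)) by ring.
      eapply Rle_trans; [apply Rabs_triang|]. rewrite Rabs_Ropp. unfold A in *. lra. }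
    pose proof (Rabs_pos (integral_curve F c x v t - y t)).
    apply Rminus_diag_uniq. apply Rabs_eq_0. lra. }
  assert (Ex : forall t, 0 <= t -> integral_curve F1 x0 x v t = x t)
    by (apply (Efix F1 x0 (fun k => fst (picard k)) x); auto).
  assert (Ev : forall t, 0 <= t -> integral_curve F2 v0 x v t = v t)
    by (apply (Efix F2 v0 (fun k => snd (picard k)) v); auto).
  (* [x] and [v] are even by construction and may have a corner at 0; the integral curves agree with
     them for nonnegative times and have two-sided derivatives everywhere. *)
  exists (integral_curve F1 x0 x v), (integral_curve F2 v0 x v).
  split; [apply integral_curve_0|]. split; [apply integral_curve_0|].
  assert (Habs : forall t, x (Rabs t) = x t /\ v (Rabs t) = v t).
  { intros t. unfold x, v. rewrite Rabs_Rabsolu. auto. }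
  split; intros t; rewrite Ex, Ev by apply Rabs_pos;
    destruct (Habs t) as [-> ->]; apply integral_curve_derive; auto.
Qed.

End Picard.

(** * Locally Lipschitz fields of polynomial growth *)

(** The same polynomial in the radius bounds both the size and the Lipschitz constant, so that
    dividing by one power of $1+|x|+|v|$ can tame both. *)
Definition tame_with (C : R) (N : nat) (f : R -> R -> R) : Prop :=
  forall r x v x' v', Rabs x + Rabs v <= r -> Rabs x' + Rabs v' <= r ->
    Rabs (f x v) <= C * (1 + r) ^ N /\
    Rabs (f x' v' - f x v) <= C * (1 + r) ^ N * (Rabs (x' - x) + Rabs (v' - v)).

Definition tame (f : R -> R -> R) : Prop :=
  exists (C : R) (N : nat), 0 <= C /\ tame_with C N f.

Lemma radius_nonneg (x v r : R) : Rabs x + Rabs v <= r -> 0 <= r.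
Proof. intros. pose proof (Rabs_pos x). pose proof (Rabs_pos v). lra. Qed.

Lemma tame_with_weaken C N C' N' f :
  0 <= C -> C <= C' -> (N <= N')%nat -> tame_with C N f -> tame_with C' N' f.
Proof.
  intros HC HCC HN Hf r x v x' v' H H'.
  pose proof (radius_nonneg _ _ _ H) as Hr.
  destruct (Hf r x v x' v' H H') as [H1 H2].
  assert (Hle : C * (1 + r) ^ N <= C' * (1 + r) ^ N').
  { apply Rmult_le_compat; auto.
    - apply pow_le; lra.
    - apply Rle_pow; [lra|auto]. }
  split; [lra|]. eapply Rle_trans; [exact H2|].
  apply Rmult_le_compat_r; auto.
  pose proof (Rabs_pos (x' - x)); pose proof (Rabs_pos (v' - v)); lra.
Qed.

Lemma tame_common f g : tame f -> tame g ->
  exists C N, 1 <= C /\ tame_with C N f /\ tame_with C N g.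
Proof.
  intros (C1 & N1 & H1 & Hf) (C2 & N2 & H2 & Hg).
  exists (1 + C1 + C2), (N1 + N2)%nat. split; [lra|]. split.
  - apply (tame_with_weaken C1 N1); auto; [lra|lia].
  - apply (tame_with_weaken C2 N2); auto; [lra|lia].
Qed.

Lemma tame_const c : tame (fun _ _ => c).
Proof.
  exists (Rabs c), O. split; [apply Rabs_pos|].
  intros r x v x' v' _ _. simpl. rewrite Rminus_diag, Rabs_R0.
  pose proof (Rabs_pos c). pose proof (Rabs_pos (x' - x)). pose proof (Rabs_pos (v' - v)).
  split; [lra|]. apply Rmult_le_pos; lra.
Qed.

Lemma tame_fst : tame (fun x _ => x).
Proof.
  exists 1, 1%nat. split; [lra|].
  intros r x v x' v' H H'. simpl. pose proof (radius_nonneg _ _ _ H).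
  pose proof (Rabs_pos v). pose proof (Rabs_pos (x' - x)). pose proof (Rabs_pos (v' - v)).
  split; nra.
Qed.

Lemma tame_snd : tame (fun _ v => v).
Proof.
  exists 1, 1%nat. split; [lra|].
  intros r x v x' v' H H'. simpl. pose proof (radius_nonneg _ _ _ H).
  pose proof (Rabs_pos x). pose proof (Rabs_pos (x' - x)). pose proof (Rabs_pos (v' - v)).
  split; nra.
Qed.

Lemma tame_plus f g : tame f -> tame g -> tame (fun x v => f x v + g x v).
Proof.
  intros Hf Hg. destruct (tame_common f g Hf Hg) as (C & N & HC & H1 & H2).
  exists (2 * C), N. split; [lra|].
  intros r x v x' v' H H'.
  destruct (H1 r x v x' v' H H') as [A1 A2], (H2 r x v x' v' H H') as [B1 B2].
  split.
  - eapply Rle_trans; [apply Rabs_triang|]. lra.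
  - replace (f x' v' + g x' v' - (f x v + g x v))
      with ((f x' v' - f x v) + (g x' v' - g x v)) by ring.
    eapply Rle_trans; [apply Rabs_triang|]. lra.
Qed.

Lemma tame_mult f g : tame f -> tame g -> tame (fun x v => f x v * g x v).
Proof.
  intros Hf Hg. destruct (tame_common f g Hf Hg) as (C & N & HC & H1 & H2).
  exists (2 * C * C), (N + N)%nat. split; [nra|].
  intros r x v x' v' H H'.
  destruct (H1 r x v x' v' H H') as [A1 A2], (H2 r x v x' v' H H') as [B1 B2].
  destruct (H2 r x' v' x' v' H' H') as [B1' _].
  pose proof (radius_nonneg _ _ _ H) as Hr.
  rewrite pow_add. assert (0 < (1 + r) ^ N) by (apply pow_lt; lra).
  set (K := (1 + r) ^ N) in *.
  assert (0 < C * K) by (apply Rmult_lt_0_compat; lra).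
  set (d := Rabs (x' - x) + Rabs (v' - v)) in *.
  pose proof (Rabs_pos (f x v)); pose proof (Rabs_pos (g x v)).
  pose proof (Rabs_pos (g x' v')).
  pose proof (Rabs_pos (f x' v' - f x v)); pose proof (Rabs_pos (g x' v' - g x v)).
  split.
  - rewrite Rabs_mult. apply Rle_trans with ((C * K) * (C * K)); [|nra].
    apply Rmult_le_compat; auto.
  - replace (f x' v' * g x' v' - f x v * g x v)
      with ((f x' v' - f x v) * g x' v' + f x v * (g x' v' - g x v)) by ring.
    eapply Rle_trans; [apply Rabs_triang|]. rewrite !Rabs_mult.
    assert (Rabs (f x' v' - f x v) * Rabs (g x' v') <= (C * K * d) * (C * K))
      by (apply Rmult_le_compat; auto).
    assert (Rabs (f x v) * Rabs (g x' v' - g x v) <= (C * K) * (C * K * d))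
      by (apply Rmult_le_compat; auto).
    lra.
Qed.

Lemma tame_ext f g : (forall x v, f x v = g x v) -> tame f -> tame g.
Proof.
  intros Heq (C & N & HC & H). exists C, N. split; auto.
  intros r x v x' v'. rewrite <- !Heq. apply H.
Qed.

Lemma tame_opp f : tame f -> tame (fun x v => - f x v).
Proof.
  intros Hf. apply (tame_ext (fun x v => -1 * f x v)); [intros; ring|].
  apply tame_mult; auto. apply tame_const.
Qed.

Lemma tame_pow f k : tame f -> tame (fun x v => f x v ^ k).
Proof.
  intros Hf. induction k as [|k IH]; simpl.
  - apply tame_const.
  - apply (tame_mult f (fun x v => f x v ^ k)); auto.
Qed.

(** [D] confines the demands on [psi] to the range of [f]: negative real powers of the energy are
    bounded and Lipschitz only away from 0. *)
Lemma tame_comp (psi : R -> R) (D : R -> Prop) (M : R) f :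
  0 <= M ->
  (forall e, D e -> Rabs (psi e) <= M) ->
  (forall e e', D e -> D e' -> Rabs (psi e' - psi e) <= M * Rabs (e' - e)) ->
  (forall x v, D (f x v)) ->
  tame f -> tame (fun x v => psi (f x v)).
Proof.
  intros HM Hb Hl HD (C & N & HC & Hf).
  exists (M * (1 + C)), N. split; [nra|].
  intros r x v x' v' H H'. destruct (Hf r x v x' v' H H') as [_ H2].
  pose proof (radius_nonneg _ _ _ H) as Hr.
  assert (1 <= (1 + r) ^ N) by (apply pow_R1_Rle; lra).
  set (K := (1 + r) ^ N) in *.
  assert (0 <= M * C) by nra.
  split.
  - eapply Rle_trans; [apply Hb, HD|]. nra.
  - eapply Rle_trans; [apply Hl; apply HD|].
    pose proof (Rabs_pos (x' - x)); pose proof (Rabs_pos (v' - v)).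
    set (d := Rabs (x' - x) + Rabs (v' - v)) in *.
    apply Rle_trans with (M * (C * K * d)); [apply Rmult_le_compat_l; auto|].
    assert (0 <= M * K * d).
    { apply Rmult_le_pos; [apply Rmult_le_pos; lra|unfold d; lra]. }
    lra.
Qed.

(** By the mean value theorem the bound on [g] is a Lipschitz bound for [G]; integrating it from 0
    costs one more power of $1+r$ and the constant [Rabs (G 0)]. *)
Lemma tame_antiderivative (g G : R -> R) :
  (forall x, is_derive G x (g x)) ->
  tame (fun x _ => g x) -> tame (fun x _ => G x).
Proof.
  intros HG (C & N & HC & Hg).
  assert (Hl : forall r x x', Rabs x <= r -> Rabs x' <= r ->
    Rabs (G x' - G x) <= C * (1 + r) ^ N * Rabs (x' - x)).
  { intros r x x' Hx Hx'.
    destruct (MVT_gen G x x' g) as [c [Hc ->]].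
    - intros; apply HG.
    - intros. eapply is_derive_continuity_pt, HG.
    - rewrite Rabs_mult. apply Rmult_le_compat_r; [apply Rabs_pos|].
      assert (Hcr : Rabs c <= r).
      { apply Rabs_le_between in Hx, Hx'. apply Rabs_le.
        unfold Rmin, Rmax in Hc. destruct (Rle_dec x x'); lra. }
      destruct (Hg r c 0 c 0) as [H _]; rewrite ?Rabs_R0; try lra. }
  exists (Rabs (G 0) + C), (S N). pose proof (Rabs_pos (G 0)) as HG0. split; [lra|].
  intros r x v x' v' H H'.
  pose proof (radius_nonneg _ _ _ H) as Hr.
  pose proof (Rabs_pos v); pose proof (Rabs_pos v').
  assert (HK : 1 <= (1 + r) ^ N) by (apply pow_R1_Rle; lra).
  assert (G1 : Rabs (G x' - G x) <= C * (1 + r) ^ N * Rabs (x' - x))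
    by (apply Hl; lra).
  assert (G2 : Rabs (G x - G 0) <= C * (1 + r) ^ N * Rabs (x - 0))
    by (apply Hl; rewrite ?Rabs_R0; lra).
  rewrite Rminus_0_r in G2. simpl.
  set (K := (1 + r) ^ N) in *.
  assert (HCK : 0 <= C * K) by (apply Rmult_le_pos; lra).
  split.
  - replace (G x) with (G 0 + (G x - G 0)) by ring.
    eapply Rle_trans; [apply Rabs_triang|].
    assert (C * K * Rabs x <= C * K * r) by (apply Rmult_le_compat_l; lra).
    assert (0 <= Rabs (G 0) * (K - 1)) by (apply Rmult_le_pos; lra).
    assert (0 <= Rabs (G 0) * (r * K)) by (apply Rmult_le_pos; [lra|apply Rmult_le_pos; lra]).
    lra.
  - eapply Rle_trans; [exact G1|].
    pose proof (Rabs_pos (x' - x)); pose proof (Rabs_pos (v' - v)).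
    apply Rmult_le_compat; try lra.
    assert (0 <= Rabs (G 0) * K) by (apply Rmult_le_pos; lra).
    assert (0 <= r * (Rabs (G 0) * K)) by (apply Rmult_le_pos; lra).
    assert (0 <= r * (C * K)) by (apply Rmult_le_pos; lra).
    lra.
Qed.

(** * Slowing a field down to a global flow *)

Definition slowdown (N : nat) (x v : R) : R := / (1 + (Rabs x + Rabs v)) ^ N.

Lemma slowdown_pos N x v : 0 < slowdown N x v.
Proof.
  unfold slowdown. apply Rinv_0_lt_compat, pow_lt.
  pose proof (Rabs_pos x); pose proof (Rabs_pos v); lra.
Qed.

Lemma slowdown_ge N x v r : Rabs x + Rabs v <= r -> / (1 + r) ^ N <= slowdown N x v.
Proof.
  intros H. unfold slowdown.
  pose proof (Rabs_pos x); pose proof (Rabs_pos v).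
  apply Rinv_le_contravar; [apply pow_lt; lra|]. apply pow_incr; lra.
Qed.

Lemma bernoulli_le (q : R) (N : nat) : 0 <= q <= 1 -> 1 - q ^ N <= INR N * (1 - q).
Proof.
  intros Hq. induction N as [|N IH]; [simpl; lra|].
  rewrite S_INR. simpl.
  assert (q ^ N <= 1) by (rewrite <- (pow1 N); apply pow_incr; lra).
  assert (q * (1 - q ^ N) <= 1 * (1 - q ^ N)) by (apply Rmult_le_compat_r; lra). lra.
Qed.

Lemma slowdown_bounded C N f x v :
  tame_with C N f -> Rabs (slowdown N x v * f x v) <= C.
Proof.
  intros Hf. pose proof (slowdown_pos N x v) as Hp.
  rewrite Rabs_mult, (Rabs_right (slowdown N x v)) by lra.
  destruct (Hf (Rabs x + Rabs v) x v x v) as [H _]; try lra.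
  apply Rmult_le_compat_l with (r := slowdown N x v) in H; [|lra].
  eapply Rle_trans; [exact H|]. right. unfold slowdown. field.
  apply pow_nonzero. pose proof (Rabs_pos x); pose proof (Rabs_pos v); lra.
Qed.

(** Let $s\le r$ be the two radii. The variation of [f] is multiplied by the slowdown at the farther
    point, whose $(1+r)^{-N}$ cancels the Lipschitz constant on the larger ball. The variation of
    the slowdown multiplies [f] at the nearer point, and Bernoulli's inequality at $(1+s)/(1+r)$
    bounds their product by a multiple of $r-s$. *)
Lemma slowdown_lipschitz C N f x v x' v' :
  0 <= C -> tame_with C N f ->
  Rabs (slowdown N x' v' * f x' v' - slowdown N x v * f x v)
    <= C * (1 + INR N) * (Rabs (x' - x) + Rabs (v' - v)).
Proof.
  intros HC Hf.
  assert (Hwlog : forall x v x' v', Rabs x + Rabs v <= Rabs x' + Rabs v' ->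
    Rabs (slowdown N x' v' * f x' v' - slowdown N x v * f x v)
    <= C * (1 + INR N) * (Rabs (x' - x) + Rabs (v' - v))).
  { clear x v x' v'. intros x v x' v' Hle.
    set (s := Rabs x + Rabs v) in *. set (r := Rabs x' + Rabs v') in *.
    assert (Hs : 0 <= s) by (apply (radius_nonneg x v); unfold s; lra).
    assert (Hd : r - s <= Rabs (x' - x) + Rabs (v' - v)).
    { unfold r, s. pose proof (Rabs_triang_inv x' x). pose proof (Rabs_triang_inv v' v). lra. }
    set (d := Rabs (x' - x) + Rabs (v' - v)) in *.
    destruct (Hf r x v x' v') as [_ H2]; [unfold s in Hle; lra|unfold r; lra|].
    destruct (Hf s x v x v) as [H1 _]; [unfold s; lra|unfold s; lra|].
    fold d in H2.
    assert (P1 : 0 < (1 + s) ^ N) by (apply pow_lt; lra).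
    assert (P2 : 0 < (1 + r) ^ N) by (apply pow_lt; lra).
    set (h := slowdown N x v). set (h' := slowdown N x' v').
    assert (Eh : h = / (1 + s) ^ N) by reflexivity.
    assert (Eh' : h' = / (1 + r) ^ N) by reflexivity.
    assert (Hq : 0 <= (1 + s) / (1 + r) <= 1).
    { split; [apply Rdiv_le_0_compat; lra|]. apply -> Rdiv_le_1; lra. }
    assert (Hdiff : (h - h') * (1 + s) ^ N <= INR N * d).
    { replace ((h - h') * (1 + s) ^ N) with (1 - ((1 + s) / (1 + r)) ^ N).
      - eapply Rle_trans; [apply bernoulli_le; auto|].
        apply Rmult_le_compat_l; [apply pos_INR|].
        replace (1 - (1 + s) / (1 + r)) with ((r - s) / (1 + r)) by (field; lra).
        apply Rle_trans with (r - s); [|lra].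
        apply Rle_div_l; nra.
      - rewrite Eh, Eh'. unfold Rdiv. rewrite Rpow_mult_distr, pow_inv. field. lra. }
    assert (Hhh : 0 <= h - h').
    { rewrite Eh, Eh'.
      assert (/ (1 + r) ^ N <= / (1 + s) ^ N); [|lra].
      apply Rinv_le_contravar; auto. apply pow_incr; lra. }
    assert (Hh' : 0 < h') by apply slowdown_pos.
    replace (h' * f x' v' - h * f x v)
      with (h' * (f x' v' - f x v) - (h - h') * f x v) by ring.
    eapply Rle_trans; [apply Rabs_triang|]. rewrite Rabs_Ropp, !Rabs_mult.
    rewrite (Rabs_right h'), (Rabs_right (h - h')) by lra.
    assert (A1 : h' * Rabs (f x' v' - f x v) <= C * d).
    { apply Rmult_le_compat_l with (r := h') in H2; [|lra].
      eapply Rle_trans; [exact H2|]. right. rewrite Eh'. field. lra. }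
    assert (A2 : (h - h') * Rabs (f x v) <= C * (INR N * d)).
    { apply Rmult_le_compat_l with (r := h - h') in H1; [|lra].
      eapply Rle_trans; [exact H1|].
      replace ((h - h') * (C * (1 + s) ^ N)) with (C * ((h - h') * (1 + s) ^ N)) by ring.
      apply Rmult_le_compat_l; auto. }
    lra. }
  destruct (Rle_dec (Rabs x + Rabs v) (Rabs x' + Rabs v')) as [Hle|Hle].
  - apply Hwlog; exact Hle.
  - rewrite Rabs_minus_sym, (Rabs_minus_sym x'), (Rabs_minus_sym v').
    apply Hwlog; lra.
Qed.

(* Multiplying the field by [slowdown N] only reparametrises its trajectories,
   and makes it bounded and globally Lipschitz. *)
Lemma slow_flow (f1 f2 : R -> R -> R) (x0 v0 : R) :
  tame f1 -> tame f2 ->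
  exists (N : nat) (x v th : R -> R), x 0 = x0 /\ v 0 = v0 /\ th 0 = 0 /\
    (forall t, let h := slowdown N (x (Rabs t)) (v (Rabs t)) in
      is_derive x t (h * f1 (x (Rabs t)) (v (Rabs t))) /\
      is_derive v t (h * f2 (x (Rabs t)) (v (Rabs t))) /\
      is_derive th t h).
Proof.
  intros T1 T2. destruct (tame_common f1 f2 T1 T2) as (C & N & HC & H1 & H2).
  set (L := C * (1 + INR N)).
  assert (HL : 0 < L) by (pose proof (pos_INR N); unfold L; apply Rmult_lt_0_compat; lra).
  destruct (picard_lindelof (fun x v => slowdown N x v * f1 x v)
    (fun x v => slowdown N x v * f2 x v) L C x0 v0 HL) as (x & v & Hx0 & Hv0 & Hx & Hv).
  - intros; apply slowdown_bounded; auto.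
  - intros; apply slowdown_bounded; auto.
  - intros; apply slowdown_lipschitz; auto; lra.
  - intros; apply slowdown_lipschitz; auto; lra.
  - set (H := fun t => slowdown N (x (Rabs t)) (v (Rabs t))).
    assert (Hc : forall t, continuous H t).
    { intros t. assert (Cx : continuous (fun s => x (Rabs s)) t).
      { apply (continuous_comp Rabs x); [apply continuous_Rabs|].
        eapply is_derive_continuous, Hx. }
      assert (Cv : continuous (fun s => v (Rabs s)) t).
      { apply (continuous_comp Rabs v); [apply continuous_Rabs|].
        eapply is_derive_continuous, Hv. }
      apply (lipschitz_comp_continuous L HL (slowdown N)
               (fun s => x (Rabs s)) (fun s => v (Rabs s))); auto.
      intros x1 v1 x2 v2.
      (* The slowdown itself is the slowed constant field 1, to which the same estimate applies
         because [1 <= C]. *)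
      rewrite <- (Rmult_1_r (slowdown N x2 v2)), <- (Rmult_1_r (slowdown N x1 v1)).
      apply (slowdown_lipschitz C N (fun _ _ => 1)); [lra|].
      intros r y w y' w' Hr Hr'. rewrite Rminus_diag, Rabs_R0, Rabs_R1.
      pose proof (radius_nonneg _ _ _ Hr).
      assert (1 <= (1 + r) ^ N) by (apply pow_R1_Rle; lra).
      assert (1 * 1 <= C * (1 + r) ^ N) by (apply Rmult_le_compat; lra).
      split; [lra|]. apply Rmult_le_pos; [lra|].
      pose proof (Rabs_pos (y' - y)); pose proof (Rabs_pos (w' - w)); lra. }
    exists N, x, v, (fun t => RInt H 0 t).
    split; [auto|]. split; [auto|]. split; [apply (RInt_point 0 H)|].
    intros t. split; [apply Hx|]. split; [apply Hv|].
    apply (is_derive_RInt H _ 0); [|apply Hc].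
    apply filter_forall. intros b.
    apply (RInt_correct (V := R_CompleteNormedModule)).
    apply (ex_RInt_continuous (V := R_CompleteNormedModule)). intros; apply Hc.
Qed.

(** * Inverse functions and periodic extension *)

Lemma derive_pos_lt (f df : R -> R) :
  (forall x, 0 < df x /\ is_derive f x (df x)) ->
  forall a b, a < b -> f a < f b.
Proof.
  intros H a b Hab.
  destruct (MVT_gen f a b df) as [c [_ Heq]].
  - intros; apply H.
  - intros. eapply is_derive_continuity_pt, H.
  - assert (0 < df c * (b - a)) by (apply Rmult_lt_0_compat; [apply H|lra]). lra.
Qed.

Lemma derive_inverse (f g : R -> R) (t d r : R) :
  0 < r -> 0 < d -> (forall a b, a < b -> f a < f b) ->
  (forall s, Rabs (s - t) < r -> f (g s) = s) ->
  is_derive f (g t) d -> is_derive g t (/ d).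
Proof.
  intros Hr Hd Hinc Hinv Hf.
  assert (Hle : forall a b, f a < f b -> a < b).
  { intros a b Hab. destruct (Rlt_le_dec a b) as [|Hba]; auto.
    destruct Hba as [Hba|Hba]; [apply Hinc in Hba; lra|subst; lra]. }
  assert (Ht : f (g t) = t) by (apply Hinv; rewrite Rminus_diag, Rabs_R0; auto).
  apply is_derive_Reals in Hf. apply is_derive_Reals. intros eps Heps.
  (* The first bound keeps the quotient [k / D] above [d / 2]; the second then makes the error
     $|k/D-d|/(d\,k/D)$ less than [eps]. *)
  set (e := Rmin (d / 2) (eps * d * d / 4)).
  assert (He : 0 < e).
  { apply Rmin_pos; [lra|]. apply Rdiv_lt_0_compat; [|lra].
    apply Rmult_lt_0_compat; auto. apply Rmult_lt_0_compat; auto. }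
  assert (He1 : e <= d / 2) by apply Rmin_l.
  assert (He2 : e <= eps * d * d / 4) by apply Rmin_r.
  destruct (Hf e He) as [[del Hdel] Hlim]. simpl in Hlim.
  set (eta := Rmin r (Rmin (f (g t + del) - t) (t - f (g t - del)))).
  assert (Heta : 0 < eta).
  { pose proof (Hinc (g t) (g t + del) ltac:(lra)).
    pose proof (Hinc (g t - del) (g t) ltac:(lra)).
    apply Rmin_pos; auto. apply Rmin_pos; lra. }
  exists (mkposreal eta Heta). simpl. intros k Hk0 Hk.
  assert (Hkr : Rabs k < r) by (eapply Rlt_le_trans; [exact Hk|apply Rmin_l]).
  assert (Hk1 : Rabs k < f (g t + del) - t).
  { eapply Rlt_le_trans; [exact Hk|]. eapply Rle_trans; [apply Rmin_r|apply Rmin_l]. }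
  assert (Hk2 : Rabs k < t - f (g t - del)).
  { eapply Rlt_le_trans; [exact Hk|]. eapply Rle_trans; [apply Rmin_r|apply Rmin_r]. }
  assert (Hs : f (g (t + k)) = t + k).
  { apply Hinv. replace (t + k - t) with k by ring. auto. }
  set (D := g (t + k) - g t).
  assert (HgD : g (t + k) = g t + D) by (unfold D; ring).
  assert (HD0 : D <> 0).
  { intros HD. rewrite HgD, HD, Rplus_0_r, Ht in Hs. lra. }
  assert (HDd : Rabs D < del).
  { pose proof (Rle_abs k). pose proof (Rle_abs (- k)) as Hk'. rewrite Rabs_Ropp in Hk'.
    assert (g (t + k) < g t + del) by (apply Hle; lra).
    assert (g t - del < g (t + k)) by (apply Hle; lra).
    apply Rabs_lt_between. unfold D. lra. }
  specialize (Hlim D HD0 HDd). rewrite <- HgD, Hs, Ht in Hlim.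
  replace (t + k - t) with k in Hlim by ring. fold D.
  assert (Hq : d / 2 <= k / D).
  { apply Rabs_lt_between in Hlim. lra. }
  replace (D / k - / d) with (- ((k / D - d) / (k / D * d))) by (field; lra).
  rewrite Rabs_Ropp. unfold Rdiv at 1. rewrite Rabs_mult.
  assert (Hkd : d * d / 2 <= k / D * d).
  { replace (d * d / 2) with (d / 2 * d) by field. apply Rmult_le_compat_r; lra. }
  assert (Hdd : 0 < d * d) by (apply Rmult_lt_0_compat; auto).
  rewrite (Rabs_right (/ (k / D * d))).
  2: { apply Rle_ge, Rlt_le, Rinv_0_lt_compat. lra. }
  apply Rlt_div_l; [lra|].
  apply Rlt_le_trans with (1 := Hlim). apply Rle_trans with (1 := He2).
  apply Rle_trans with (eps * (d * d / 2)); [|apply Rmult_le_compat_l; lra].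
  assert (0 < eps * (d * d)) by (apply Rmult_lt_0_compat; auto). lra.
Qed.

(** The bound on forward time makes the supremum [T] of [th] finite, and strict monotonicity keeps
    it unattained. The inverse is given by a formula, the least upper bound of a sublevel set, whose
    value matters only on the range of [th]. *)
Lemma inverse_time (th h : R -> R) (C : R) :
  th 0 = 0 -> (forall t, 0 < h t /\ is_derive th t (h t)) ->
  (forall t, 0 <= t -> th t <= C) ->
  exists (T : R) (sg : R -> R), (forall s, th s < T) /\ sg 0 = 0 /\
    (forall t, 0 <= t < T ->
       0 <= sg t /\ th (sg t) = t /\ is_derive sg t (/ h (sg t))).
Proof.
  intros H0 Hd HC.
  pose proof (derive_pos_lt th h Hd) as Hinc.
  assert (Hle : forall a b, th a <= th b -> a <= b).
  { intros a b Hab. destruct (Rle_lt_dec a b) as [|Hba]; auto.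
    apply Hinc in Hba; lra. }
  destruct (completeness (fun y => exists s, y = th s)) as [T [Hub Hlub]].
  { exists C. intros y [s ->]. destruct (Rle_dec 0 s); [apply HC; lra|].
    apply Rle_trans with (th 0); [apply Rlt_le, Hinc; lra|apply HC; lra]. }
  { exists (th 0), 0. auto. }
  assert (HT : forall s, th s < T).
  { intros s. apply Rlt_le_trans with (th (s + 1)); [apply Hinc; lra|].
    apply Hub. eexists; eauto. }
  set (sg := fun t => real (Lub_Rbar (fun s => th s <= t))).
  assert (Hsg : forall s, sg (th s) = s).
  { intros s. unfold sg. rewrite (is_lub_Rbar_unique _ (Finite s)); auto.
    split.
    - intros y Hy. simpl. apply Hle; auto.
    - intros b Hb. apply Hb. lra. }
  (* Starting the range at [th (-1)], which is negative, makes 0 an interior point, so that the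
     inverse has a two-sided derivative there. *)
  assert (Hsurj : forall t, th (-1) < t < T -> exists s, th s = t).
  { intros t [Ht1 Ht2].
    destruct (Classical_Prop.classic (exists s, t < th s)) as [[s Hs]|Hno].
    - destruct (IVT_gen th (-1) s t) as [z [_ Hz]].
      + intros y. eapply is_derive_continuity_pt, Hd.
      + rewrite Rmin_left, Rmax_right; lra.
      + exists z; auto.
    - exfalso. apply (Rlt_not_le _ _ Ht2). apply Hlub. intros y [s ->].
      destruct (Rle_dec (th s) t); auto. exfalso; apply Hno; exists s; lra. }
  assert (Hinv : forall t, th (-1) < t < T -> th (sg t) = t).
  { intros t Ht. destruct (Hsurj t Ht) as [s <-]. rewrite Hsg; auto. }
  assert (Hm1 : th (-1) < 0) by (rewrite <- H0; apply Hinc; lra).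
  exists T, sg. split; auto. split; [rewrite <- H0 at 1; apply Hsg|].
  intros t Ht. split; [|split].
  - apply Hle. rewrite H0, Hinv; lra.
  - apply Hinv; lra.
  - apply derive_inverse with (f := th) (r := Rmin (T - t) (t - th (-1))).
    + apply Rmin_pos; lra.
    + apply Hd.
    + auto.
    + intros s Hs. apply Hinv.
      assert (Rabs (s - t) < T - t) by (eapply Rlt_le_trans; [exact Hs|apply Rmin_l]).
      assert (Rabs (s - t) < t - th (-1)) by (eapply Rlt_le_trans; [exact Hs|apply Rmin_r]).
      pose proof (Rle_abs (s - t)). pose proof (Rle_abs (- (s - t))) as Hk.
      rewrite Rabs_Ropp in Hk. lra.
    + apply Hd.
Qed.

(** * Reduction modulo a period *)

Definition wrap (P t : R) : R := t - P * IZR (Int_part (t / P)).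

Lemma wrap_eq (P t : R) (k : Z) : 0 < P ->
  0 <= t - P * IZR k < P -> wrap P t = t - P * IZR k.
Proof.
  intros HP Hk. unfold wrap. replace (Int_part (t / P)) with k; auto.
  destruct (base_Int_part (t / P)) as [H1 H2].
  assert (Hk1 : IZR k <= t / P) by (apply Rle_div_r; lra).
  assert (Hk2 : t / P < IZR k + 1) by (apply Rlt_div_l; lra).
  assert (IZR k < IZR (Int_part (t / P) + 1)) by (rewrite plus_IZR; lra).
  assert (IZR (Int_part (t / P)) < IZR (k + 1)) by (rewrite plus_IZR; lra).
  apply lt_IZR in H, H0. lia.
Qed.

Lemma wrap_bnd (P t : R) : 0 < P -> 0 <= wrap P t < P.
Proof.
  intros HP. unfold wrap. destruct (base_Int_part (t / P)) as [H1 H2].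
  apply Rle_div_r in H1; auto.
  assert (H3 : t / P < IZR (Int_part (t / P)) + 1) by lra.
  apply Rlt_div_l in H3; auto. lra.
Qed.

Lemma wrap_periodic (P t : R) : 0 < P -> wrap P (t + P) = wrap P t.
Proof.
  intros HP. pose proof (wrap_bnd P t HP) as Hw.
  rewrite (wrap_eq P (t + P) (Int_part (t / P) + 1)); auto;
    unfold wrap in *; rewrite plus_IZR; lra.
Qed.

Lemma wrap_id (P t : R) : 0 <= t < P -> wrap P t = t.
Proof. intros Ht. rewrite (wrap_eq P t 0); lra. Qed.

Lemma periodic_wrap (f : R -> R) (P t : R) :
  (forall x, f (x + P) = f x) -> f (wrap P t) = f t.
Proof.
  intros Hf.
  assert (Hnat : forall k x, f (x + P * INR k) = f x).
  { intros k; induction k as [|k IH]; intros x.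
    - simpl. f_equal; ring.
    - rewrite S_INR. replace (x + P * (INR k + 1)) with (x + P * INR k + P) by ring.
      rewrite Hf; apply IH. }
  unfold wrap. set (k := Int_part (t / P)).
  destruct (Z_le_dec 0 k).
  - rewrite <- (Z2Nat.id k), <- INR_IZR_INZ by lia.
    rewrite <- (Hnat (Z.to_nat k) (t - _)). f_equal; ring.
  - rewrite <- (Z.opp_involutive k), opp_IZR, <- (Z2Nat.id (- k)), <- INR_IZR_INZ by lia.
    rewrite <- (Hnat (Z.to_nat (- k)) t). f_equal; ring.
Qed.

Lemma periodic_extremum (f : R -> R) :
  periodic f -> (forall x, continuous f x) ->
  exists l u, forall x, f l <= f x <= f u.
Proof.
  intros (P & HP & Hf) Hc.
  assert (Hc' : forall c, 0 <= c <= P -> continuity_pt f c)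
    by (intros; apply continuity_pt_filterlim, Hc).
  destruct (continuity_ab_maj f 0 P) as [u [Hu _]]; [lra|auto|].
  destruct (continuity_ab_min f 0 P) as [l [Hl _]]; [lra|auto|].
  exists l, u. intros x. rewrite <- (periodic_wrap f P x Hf).
  pose proof (wrap_bnd P x HP). split; [apply Hl|apply Hu]; lra.
Qed.

(** Since [f] vanishes outside (0, P), the periodic extension coincides within distance [P] of [t]
    with the sum of three consecutive translates of [f]; no gluing at the multiples of [P] is
    required. *)
Lemma continuous_wrap (f : R -> R) (P : R) :
  0 < P -> (forall t, continuous f t) ->
  (forall t, t <= 0 \/ P <= t -> f t = 0) ->
  forall t, continuous (fun s => f (wrap P s)) t.
Proof.
  intros HP Hc H0 t. set (k := Int_part (t / P)).
  assert (Hshift : forall c, continuous (fun s => f (s - c)) t).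
  { intros c. apply (continuous_comp (fun s => s - c) f); [|apply Hc].
    apply (is_derive_continuous _ t 1). auto_derive; [trivial|ring]. }
  apply (continuous_ext_loc _
    (fun s => f (s - P * IZR (k - 1)) + f (s - P * IZR k) + f (s - P * IZR (k + 1)))).
  - exists (mkposreal P HP). intros s Hs.
    unfold ball in Hs; simpl in Hs; unfold AbsRing_ball, abs, minus, plus, opp in Hs.
    simpl in Hs. apply Rabs_lt_between in Hs.
    pose proof (wrap_bnd P t HP) as Hw. unfold wrap in Hw. fold k in Hw.
    rewrite plus_IZR, minus_IZR.
    destruct (Rlt_dec s (P * IZR k)) as [H1|H1].
    + rewrite (wrap_eq P s (k - 1)) by (rewrite ?minus_IZR; lra). rewrite minus_IZR.
      rewrite (H0 (s - P * IZR k)), (H0 (s - P * (IZR k + 1))); lra.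
    + destruct (Rlt_dec s (P * (IZR k + 1))) as [H2|H2].
      * rewrite (wrap_eq P s k) by lra.
        rewrite (H0 (s - P * (IZR k - 1))), (H0 (s - P * (IZR k + 1))); lra.
      * rewrite (wrap_eq P s (k + 1)) by (rewrite ?plus_IZR; lra). rewrite plus_IZR.
        rewrite (H0 (s - P * (IZR k - 1))), (H0 (s - P * IZR k)); lra.
  - apply (continuous_plus (fun s => f (s - P * IZR (k - 1)) + f (s - P * IZR k))); auto.
    apply (continuous_plus (fun s => f (s - P * IZR (k - 1)))); auto.
Qed.

(** * The energy of the oscillator with feedback *)

Lemma pow_even_nonneg (x : R) (k : nat) : 0 <= x ^ (2 * k).
Proof. rewrite pow_mult. apply pow_le, pow2_ge_0. Qed.

Lemma pow_le_inv (x y : R) (k : nat) : 0 <= y -> x ^ S k <= y ^ S k -> x <= y.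
Proof.
  intros Hy H. destruct (Rle_lt_dec x y) as [|Hlt]; [auto|].
  exfalso. assert (y ^ S k < x ^ S k); [|lra].
  clear H. induction k as [|k IH]; [simpl; lra|].
  change (y * y ^ S k < x * x ^ S k).
  assert (0 <= y ^ S k) by (apply pow_le; auto).
  apply Rmult_le_0_lt_compat; auto.
Qed.

(* Here [w = x^(2n+2)/E], [s = v^2/E], [X = x g(x)/E], [b = B/E] and
   [pi = rho x v/E]. *)
Lemma lyapunov_rate (al be K mu ga ka M rho w s X b pi : R) :
  0 < al <= 1 -> 1 <= be -> K = 12 * be ->
  0 < ga <= 1 -> 0 < mu -> 1 <= rho -> 0 <= M ->
  0 <= w -> al * w <= 1 -> 0 <= s -> 0 <= b ->
  2 - 2 * b - 2 * be * w <= s ->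
  al * w - b <= X -> X <= be * w ->
  6 * b <= 1 -> K * b <= al ->
  Rabs pi * rho <= 2 / al ->
  4 * K * (1 + K / al) / al ^ 3 <= rho ->
  mu * (K * M + 2 / al * (1 + 2 * (K / al))) <= ka * ga ->
  mu * (al / (2 * K)) <=
    ka * ga * (w * s)
    + mu * (s - (1 - K * w) * X + (1 - K * w) * (ga * pi * w)
            - K * M * (w * s) - ga * (w * s) * pi * (1 - 2 * K * w)).
Proof.
  intros Hal Hbe HK Hga Hmu Hrho HM Hw Hw1 Hs Hb Hs2 HX1 HX2 Hb6 HbK Hpi Hrho2 Hmu2.
  assert (HK12 : 12 <= K) by lra.
  assert (HwA : w <= / al).
  { apply Rmult_le_reg_l with al; [lra|]. rewrite Rinv_r by lra. exact Hw1. }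
  assert (HKw : Rabs (1 - K * w) <= 1 + K / al).
  { assert (K * w <= K * / al) by (apply Rmult_le_compat_l; lra).
    assert (0 <= K * w) by (apply Rmult_le_pos; lra).
    unfold Rdiv. apply Rabs_le. lra. }
  assert (HKw2 : Rabs (1 - 2 * K * w) <= 1 + 2 * (K / al)).
  { assert (K * w <= K * / al) by (apply Rmult_le_compat_l; lra).
    assert (0 <= K * w) by (apply Rmult_le_pos; lra).
    unfold Rdiv. apply Rabs_le. lra. }
  assert (Hai : 0 < / al) by (apply Rinv_0_lt_compat; lra).
  assert (HpiA : Rabs pi <= 2 / al).
  { pose proof (Rabs_pos pi). nra. }
  assert (HKal : 0 < K / al) by (apply Rdiv_lt_0_compat; lra).
  (* For [K w <= 2] the kinetic part [s] is at least 1 up to small terms; for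
     [K w > 2] the factor [K w - 1] makes the restoring force contribute positively. *)
  assert (Hmain : al / K <= s - (1 - K * w) * X).
  { assert (HaK : al / K <= / 12).
    { apply Rle_div_l; [lra|]. lra. }
    destruct (Rle_dec (K * w) 2) as [Hle|Hgt].
    - assert (Hbw : be * w <= / 6) by (rewrite HK in Hle; lra).
      destruct (Rle_dec (K * w) 1) as [Hle1|Hgt1].
      + assert ((1 - K * w) * X <= be * w).
        { assert (0 <= K * w) by (apply Rmult_le_pos; lra).
          assert (0 <= be * w) by (apply Rmult_le_pos; lra). nra. }
        lra.
      + assert (- b <= X) by nra.
        assert ((1 - K * w) * X <= b) by nra. lra.
    - assert (HbK' : b <= al / K) by (apply Rle_div_r; lra).
      assert (al / K <= X).
      { apply Rle_trans with (al * w - b); auto.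
        assert (2 * (al / K) <= al * w); [|lra].
        replace (2 * (al / K)) with (al * (2 / K)) by (field; lra).
        apply Rmult_le_compat_l; [lra|]. apply Rle_div_l; lra. }
      nra. }
  (* The feedback acting on the corrector costs at most half of the main term, because [Rabs pi] is
     of order [1 / rho] and [rho] is large. *)
  assert (Herr : - (al / (2 * K)) <= (1 - K * w) * (ga * pi * w)).
  { assert (Rabs ((1 - K * w) * (ga * pi * w)) <= al / (2 * K)).
    { rewrite !Rabs_mult, (Rabs_right ga), (Rabs_right w) by lra.
      assert (E1 : ga * Rabs pi * w <= 1 * (2 / al / rho) * / al).
      { pose proof (Rabs_pos pi).
        apply Rmult_le_compat; try lra.
        - apply Rmult_le_pos; lra.
        - apply Rmult_le_compat; try lra. apply Rle_div_r; lra. }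
      apply Rle_trans with ((1 + K / al) * (1 * (2 / al / rho) * / al)).
      - apply Rmult_le_compat; auto; [apply Rabs_pos|].
        pose proof (Rabs_pos pi). apply Rmult_le_pos; [apply Rmult_le_pos|]; lra.
      - replace ((1 + K / al) * (1 * (2 / al / rho) * / al))
          with ((4 * K * (1 + K / al) / al ^ 3) / rho * (al / (2 * K)))
          by (field; lra).
        rewrite <- (Rmult_1_l (al / (2 * K))) at 2.
        apply Rmult_le_compat_r; [apply Rdiv_le_0_compat; lra|].
        apply Rle_div_l; lra. }
    apply Rabs_le_between in H. lra. }
  assert (HJ : 0 <= w * s) by (apply Rmult_le_pos; lra).
  assert (Hpi2 : ga * (pi * (1 - 2 * K * w)) <= 2 / al * (1 + 2 * (K / al))).
  { apply Rle_trans with (1 * (2 / al * (1 + 2 * (K / al)))); [|lra].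
    assert (Rabs (pi * (1 - 2 * K * w)) <= 2 / al * (1 + 2 * (K / al))).
    { rewrite Rabs_mult. apply Rmult_le_compat; auto; apply Rabs_pos. }
    pose proof (Rle_abs (pi * (1 - 2 * K * w))).
    pose proof (Rabs_pos (pi * (1 - 2 * K * w))).
    apply Rle_trans with (ga * Rabs (pi * (1 - 2 * K * w))).
    - apply Rmult_le_compat_l; lra.
    - apply Rmult_le_compat; lra. }
  (* All terms carrying the factor [w * s] are charged to the gain [ka * ga * (w * s)]. *)
  assert (HJ2 : mu * (K * M + ga * (pi * (1 - 2 * K * w))) * (w * s) <= ka * ga * (w * s)).
  { apply Rmult_le_compat_r; auto.
    eapply Rle_trans; [|exact Hmu2]. apply Rmult_le_compat_l; lra. }
  assert (Hhalf : al / (2 * K) + al / (2 * K) = al / K) by (field; lra).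
  assert (mu * (al / (2 * K)) <=
    mu * (s - (1 - K * w) * X + (1 - K * w) * (ga * pi * w))).
  { apply Rmult_le_compat_l; lra. }
  lra.
Qed.

(** * Real powers on the half-line from 1 *)

Lemma is_derive_Rpower (c e : R) :
  0 < e -> is_derive (fun y => Rpower y c) e (c * Rpower e (c - 1)).
Proof.
  intros He. apply is_derive_Reals.
  replace (c * Rpower e (c - 1)) with (c * (Rpower e (c - 1))) by ring.
  apply derivable_pt_lim_power; auto.
Qed.

Lemma Rpower_minus_1 (e c : R) : 0 < e -> Rpower e (c - 1) = Rpower e c / e.
Proof.
  intros He. unfold Rminus. rewrite Rpower_plus, Rpower_Ropp, Rpower_1; auto.
Qed.

Lemma Rpower_ge_1 (e c : R) : 1 <= e -> 0 <= c -> 1 <= Rpower e c.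
Proof.
  intros He Hc. rewrite <- (Rpower_O e) by lra. apply Rle_Rpower; lra.
Qed.

Lemma Rpower_le_1 (e c : R) : 1 <= e -> c <= 0 -> Rpower e c <= 1.
Proof.
  intros He Hc. rewrite <- (Rpower_O e) by lra. apply Rle_Rpower; lra.
Qed.

Lemma Rpower_lipschitz (c e e' : R) : -1 <= c <= 0 -> 1 <= e -> 1 <= e' ->
  Rabs (Rpower e' c - Rpower e c) <= 1 * Rabs (e' - e).
Proof.
  intros Hc He He'.
  destruct (MVT_gen (fun y => Rpower y c) e e' (fun y => c * Rpower y (c - 1)))
    as [z [Hz ->]].
  - intros y Hy. apply is_derive_Rpower.
    unfold Rmin, Rmax in Hy. destruct (Rle_dec e e'); lra.
  - intros y Hy. eapply is_derive_continuity_pt, is_derive_Rpower.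
    unfold Rmin, Rmax in Hy. destruct (Rle_dec e e'); lra.
  - assert (Hz1 : 1 <= z) by (unfold Rmin, Rmax in Hz; destruct (Rle_dec e e'); lra).
    rewrite Rabs_mult. apply Rmult_le_compat_r; [apply Rabs_pos|].
    pose proof (Rpower_le_1 z (c - 1) Hz1 ltac:(lra)).
    assert (0 < Rpower z (c - 1)) by apply exp_pos.
    apply Rabs_le. split; nra.
Qed.

Section Oscillator.

Variables (n m : nat) (g G : R -> R) (al be B : R).
Hypothesis n_pos : (0 < n)%nat.
Hypothesis m_lt_n : (m < n)%nat.
Hypothesis n_lt_2m : (n + 1 <= 2 * m)%nat.
Hypothesis al_bnd : 0 < al <= 1.
Hypothesis be_bnd : 1 <= be.
Hypothesis B_bnd : 0 <= B.
Hypothesis g_bnd : forall x,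
  al * x ^ (2 * n + 2) - B <= x * g x <= be * x ^ (2 * n + 2).
Hypothesis G_bnd : forall x,
  1 + al * x ^ (2 * n + 2) <= G x <= B + be * x ^ (2 * n + 2).
Hypothesis G_derive : forall x, is_derive G x (g x).
Hypothesis g_tame : tame (fun x _ => g x).

(** [G_bnd] fixes the additive constant of the potential so that the energy is at least 1; its real
    powers and the quotients by it are then regular everywhere. *)
Definition energy (x v : R) : R := v ^ 2 / 2 + G x.
(** In powers of [rho]: $x=O(\rho^2)$, $v=O(\rho^{2n+2})$ and $E=\rho^{4n+4}$, so the feedback is
    $O(\rho^{2n-4m+1})$. The condition $n+1\le2m$ says exactly that this exponent is at most
    $-1$. *)
Definition kappa : R := / INR (4 * n + 4).
Definition rho (x v : R) : R := Rpower (energy x v) kappa.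
(* The constant makes [Rabs (feedback x v) <= / (2 * rho x v)]. *)
Definition gain : R := al ^ (2 * (n - m) + 1) / 4.
Definition feedback (x v : R) : R :=
  gain * x ^ (2 * (n - m) + 1) * v * Rpower (energy x v) (kappa - 1).

Lemma even_pow_nonneg x : 0 <= x ^ (2 * n + 2).
Proof. replace (2 * n + 2)%nat with (2 * (n + 1))%nat by lia. apply pow_even_nonneg. Qed.

Lemma potential_le_energy x v : 1 + al * x ^ (2 * n + 2) <= energy x v.
Proof. unfold energy. pose proof (pow2_ge_0 v). pose proof (proj1 (G_bnd x)). lra. Qed.

Lemma energy_ge_1 x v : 1 <= energy x v.
Proof.
  pose proof (potential_le_energy x v). pose proof (even_pow_nonneg x). nra.
Qed.

Lemma v_le_energy x v : v ^ 2 <= 2 * energy x v.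
Proof.
  unfold energy. pose proof (proj1 (G_bnd x)). pose proof (even_pow_nonneg x). nra.
Qed.

Lemma kappa_bnd : 0 < kappa <= 1.
Proof.
  unfold kappa. assert (1 <= INR (4 * n + 4)) by (apply (le_INR 1); lia).
  split; [apply Rinv_0_lt_compat; lra|].
  rewrite <- Rinv_1. apply Rinv_le_contravar; lra.
Qed.

Lemma rho_ge_1 x v : 1 <= rho x v.
Proof.
  pose proof (energy_ge_1 x v). pose proof kappa_bnd. apply Rpower_ge_1; lra.
Qed.

Lemma rho_pow x v : rho x v ^ (4 * n + 4) = energy x v.
Proof.
  pose proof (energy_ge_1 x v).
  rewrite <- Rpower_pow by apply exp_pos. unfold rho. rewrite Rpower_mult.
  unfold kappa. rewrite Rinv_l by (apply not_0_INR; lia). apply Rpower_1; lra.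
Qed.

Lemma rho_large M x v : M ^ (4 * n + 4) <= energy x v -> M <= rho x v.
Proof.
  intros H. rewrite <- (rho_pow x v) in H.
  apply (pow_le_inv _ _ (4 * n + 3)).
  - pose proof (rho_ge_1 x v); lra.
  - replace (S (4 * n + 3)) with (4 * n + 4)%nat by lia. exact H.
Qed.

(** Comparing powers [S n] avoids roots: $al\le1$ gives $(al\,x^2)^{n+1}\le al\,x^{2n+2}\le
    E=(\rho^4)^{n+1}$. *)
Lemma x_le_rho x v : al * x ^ 2 <= rho x v ^ 4.
Proof.
  apply (pow_le_inv _ _ n); [apply pow_le; pose proof (rho_ge_1 x v); lra|].
  rewrite <- pow_mult. replace (4 * S n)%nat with (4 * n + 4)%nat by lia.
  rewrite rho_pow, Rpow_mult_distr, <- pow_mult.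
  replace (2 * S n)%nat with (2 * n + 2)%nat by lia.
  pose proof (potential_le_energy x v). pose proof (even_pow_nonneg x).
  assert (al ^ S n <= al).
  { simpl. assert (al ^ n <= 1) by (rewrite <- (pow1 n); apply pow_incr; lra). nra. }
  nra.
Qed.

Lemma rho_pow_le i j x v : (i <= j)%nat -> rho x v ^ i <= rho x v ^ j.
Proof. intros. apply Rle_pow; auto. apply rho_ge_1. Qed.

Lemma abs_le_of_sqr (y c : R) : 1 <= c -> y ^ 2 <= c -> Rabs y <= c.
Proof.
  intros Hc Hy. apply (pow_le_inv _ _ 1); [lra|].
  change (Rabs y ^ 2 <= c ^ 2). rewrite pow2_abs. nra.
Qed.

(** The square of the left side is at most $2/al$ times $\rho^8/E$, and $8\le4n+4$ is where $n\ge1$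
    enters. The bound makes the feedback terms in the derivative of the corrector of order
    $1/\rho$. *)
Lemma pi_bnd x v :
  Rabs (rho x v * x * v / energy x v) * rho x v <= 2 / al.
Proof.
  pose proof (rho_ge_1 x v) as Hr. pose proof (energy_ge_1 x v) as HE.
  rewrite <- (Rabs_right (rho x v)) at 2 by lra. rewrite <- Rabs_mult.
  apply abs_le_of_sqr; [apply Rle_div_r; lra|].
  replace ((rho x v * x * v / energy x v * rho x v) ^ 2)
    with (v ^ 2 / energy x v * (al * x ^ 2 * rho x v ^ 4 / energy x v) / al)
    by (field; lra).
  apply Rmult_le_compat_r; [apply Rlt_le, Rinv_0_lt_compat; lra|].
  rewrite <- (Rmult_1_r 2).
  pose proof (pow2_ge_0 v). pose proof (pow2_ge_0 x).
  assert (0 < rho x v ^ 4) by (apply pow_lt; lra).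
  apply Rmult_le_compat.
  - apply Rdiv_le_0_compat; lra.
  - apply Rdiv_le_0_compat; [|lra]. apply Rmult_le_pos; [apply Rmult_le_pos|]; lra.
  - apply Rle_div_l; [lra|]. apply v_le_energy.
  - apply Rle_div_l; [lra|]. rewrite Rmult_1_l, <- (rho_pow x v).
    apply Rle_trans with (rho x v ^ 4 * rho x v ^ 4).
    + apply Rmult_le_compat_r; [lra|apply x_le_rho].
    + rewrite <- pow_add. apply rho_pow_le. lia.
Qed.

Lemma gain_bnd : 0 < gain <= 1 / 4.
Proof.
  unfold gain.
  assert (0 < al ^ (2 * (n - m) + 1)) by (apply pow_lt; lra).
  assert (al ^ (2 * (n - m) + 1) <= 1)
    by (rewrite <- (pow1 (2 * (n - m) + 1)); apply pow_incr; lra).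
  lra.
Qed.

(** After squaring, the claim compares $\rho^{4j+4}$ with $E=\rho^{4n+4}$ for $j=2(n-m)+1$; it holds
    because $j\le n$, which is the hypothesis [n_lt_2m]. The power of [al] in [gain] pays for the
    powers of [al] in [x_le_rho]. *)
Lemma feedback_bnd x v : Rabs (feedback x v) <= / (2 * rho x v).
Proof.
  pose proof (rho_ge_1 x v) as Hr. pose proof (energy_ge_1 x v) as HE.
  unfold feedback. rewrite Rpower_minus_1 by lra. fold (rho x v).
  set (j := (2 * (n - m) + 1)%nat).
  set (y := 4 * (gain * x ^ j * v * (rho x v / energy x v)) * rho x v).
  assert (Hy : Rabs y <= 2).
  { apply abs_le_of_sqr; [lra|]. unfold y, gain. fold j.
    replace ((4 * (al ^ j / 4 * x ^ j * v * (rho x v / energy x v)) * rho x v) ^ 2)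
      with ((al * x ^ 2) ^ j * al ^ j * rho x v ^ 4 / energy x v * (v ^ 2 / energy x v)).
    2: { rewrite Rpow_mult_distr, <- pow_mult, Nat.mul_comm, pow_mult. field. lra. }
    rewrite <- (Rmult_1_l 2).
    pose proof (pow2_ge_0 v). pose proof (pow2_ge_0 x).
    assert (0 < rho x v ^ 4) by (apply pow_lt; lra).
    assert (Hp1 : 0 <= (al * x ^ 2) ^ j) by (apply pow_le, Rmult_le_pos; lra).
    assert (Hp2 : 0 < al ^ j) by (apply pow_lt; lra).
    assert (Hp3 : al ^ j <= 1) by (rewrite <- (pow1 j); apply pow_incr; lra).
    apply Rmult_le_compat.
    - apply Rdiv_le_0_compat; [|lra].
      apply Rmult_le_pos; [apply Rmult_le_pos|]; lra.
    - apply Rdiv_le_0_compat; lra.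
    - apply Rle_div_l; [lra|]. rewrite Rmult_1_l.
      apply Rle_trans with (rho x v ^ (4 * j) * 1 * rho x v ^ 4).
      + apply Rmult_le_compat_r; [lra|].
        apply Rmult_le_compat; try lra.
        rewrite pow_mult. apply pow_incr. split; [apply Rmult_le_pos; lra|].
        apply x_le_rho.
      + rewrite Rmult_1_r, <- pow_add, <- (rho_pow x v). apply rho_pow_le.
        unfold j. lia.
    - apply Rle_div_l; [lra|]. apply v_le_energy. }
  replace (gain * x ^ j * v * (rho x v / energy x v)) with (y / (4 * rho x v))
    by (unfold y; field; lra).
  unfold Rdiv. rewrite Rabs_mult, (Rabs_right (/ (4 * rho x v))).
  - replace (/ (2 * rho x v)) with (2 * / (4 * rho x v)) by (field; lra).
    apply Rmult_le_compat_r; auto. apply Rlt_le, Rinv_0_lt_compat; lra.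
  - apply Rle_ge, Rlt_le, Rinv_0_lt_compat; lra.
Qed.

Lemma energy_tame : tame energy.
Proof.
  unfold energy. apply tame_plus.
  - apply tame_mult; [|apply tame_const]. apply (tame_pow (fun _ v => v)), tame_snd.
  - apply (tame_antiderivative g); auto.
Qed.

Lemma feedback_tame : tame feedback.
Proof.
  pose proof kappa_bnd. unfold feedback.
  apply tame_mult.
  - apply (tame_mult (fun x _ => gain * x ^ (2 * (n - m) + 1)) (fun _ v => v)).
    + apply (tame_mult (fun _ _ => gain)); [apply tame_const|].
      apply (tame_pow (fun x _ => x)), tame_fst.
    + apply tame_snd.
  - apply (tame_comp (fun e => Rpower e (kappa - 1)) (fun e => 1 <= e) 1).
    + lra.
    + intros e He. rewrite Rabs_right by (apply Rle_ge, Rlt_le, exp_pos).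
      apply Rpower_le_1; lra.
    + intros. apply Rpower_lipschitz; lra.
    + apply energy_ge_1.
    + apply energy_tame.
Qed.

Lemma force_tame : tame (fun x v => - g x + feedback x v * x ^ (2 * m + 1)).
Proof.
  apply tame_plus.
  - apply (tame_opp (fun x _ => g x)); auto.
  - apply tame_mult; [apply feedback_tame|].
    apply (tame_pow (fun x _ => x)), tame_fst.
Qed.

(** [h] is the speed of the original time with respect to the parameter: the slowdown factor along
    the reparametrised flow, 1 along the final solution. *)
Definition oscillation (h : R) (x v : R -> R) (t : R) : Prop :=
  is_derive x t (h * v t) /\
  is_derive v t (h * (- g (x t) + feedback (x t) (v t) * x t ^ (2 * m + 1))).

Lemma feedback_pow x v :
  feedback x v * x ^ (2 * m + 1)
  = gain * x ^ (2 * n + 2) * v * (rho x v / energy x v).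
Proof.
  pose proof (energy_ge_1 x v).
  unfold feedback. rewrite Rpower_minus_1 by lra. fold (rho x v).
  replace (2 * n + 2)%nat with ((2 * (n - m) + 1) + (2 * m + 1))%nat by lia.
  rewrite (pow_add x (2 * (n - m) + 1) (2 * m + 1)). ring.
Qed.

Lemma energy_derive h x v t : oscillation h x v t ->
  is_derive (fun s => energy (x s) (v s)) t
    (h * (gain * rho (x t) (v t) * (x t ^ (2 * n + 2) * v t ^ 2 / energy (x t) (v t)))).
Proof.
  intros [Hx Hv]. pose proof (energy_ge_1 (x t) (v t)) as HE.
  pose proof (is_derive_comp G x t _ _ (G_derive (x t)) Hx) as H1.
  assert (H2 : is_derive (fun s => v s ^ 2 / 2) t
    (v t * (h * (- g (x t) + feedback (x t) (v t) * x t ^ (2 * m + 1))))).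
  { auto_derive; [eexists; apply Hv|].
    rewrite (is_derive_unique (fun s : R => v s) t _ Hv). simpl. field. }
  unfold energy at 1. evar_last; [exact (is_derive_plus _ _ _ _ _ H2 H1)|].
  unfold plus, scal; cbn -[Nat.mul Nat.add pow IZR].
  unfold mult; cbn -[Nat.mul Nat.add pow IZR]. rewrite feedback_pow.
  match goal with |- ?a = ?b => change (@eq R a b) end. field. lra.
Qed.

Lemma rho_derive h x v t : oscillation h x v t ->
  is_derive (fun s => rho (x s) (v s)) t
    (h * (kappa * gain * rho (x t) (v t) ^ 2
          * (x t ^ (2 * n + 2) * v t ^ 2 / energy (x t) (v t) ^ 2))).
Proof.
  intros H. pose proof (energy_ge_1 (x t) (v t)) as HE.
  assert (HE0 : 0 < energy (x t) (v t)) by lra.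
  pose proof (is_derive_comp (fun y => Rpower y kappa) _ t _ _
    (is_derive_Rpower kappa _ HE0) (energy_derive h x v t H)) as H1.
  unfold rho at 1. evar_last; [exact H1|].
  unfold scal; cbn -[Nat.mul Nat.add pow IZR].
  unfold mult; cbn -[Nat.mul Nat.add pow IZR].
  rewrite Rpower_minus_1 by lra. fold (rho (x t) (v t)).
  match goal with |- ?a = ?b => change (@eq R a b) end. field. lra.
Qed.

(** Abstract functions in place of [energy] and [rho] keep the real powers out of the
    differentiation and of the field identity. *)
Lemma corrector_derive (mu K : R) (p : nat) (x v E r : R -> R) (t dx dv dE dr : R) :
  is_derive x t dx -> is_derive v t dv -> is_derive E t dE -> is_derive r t dr ->
  E t <> 0 -> r t <> 0 ->
  is_derive (fun s => - / r s + mu * (x s * v s / E s - K * x s ^ S p * v s / E s ^ 2)) t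
    (dr / r t ^ 2 + mu * ((dx * v t + x t * dv) / E t - x t * v t * dE / E t ^ 2
      - K * (INR (S p) * x t ^ p * dx * v t + x t ^ S p * dv) / E t ^ 2
      + 2 * K * x t ^ S p * v t * dE / E t ^ 3)).
Proof.
  intros Hx Hv HE Hr HE0 Hr0.
  auto_derive.
  - repeat split; try (eexists; eassumption); auto.
  - rewrite (is_derive_unique (fun s : R => x s) t _ Hx), (is_derive_unique (fun s : R => v s) t _ Hv),
      (is_derive_unique (fun s : R => E s) t _ HE), (is_derive_unique (fun s : R => r s) t _ Hr).
    change (match p with O => 1 | S _ => INR p + 1 end) with (INR (S p)).
    simpl pow. field. auto.
Qed.

(** The factor 12 yields [be * w <= 1 / 6] as long as [corr * w <= 2]; in that region kinetic energy
    outweighs the potential terms. *)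
Definition corr : R := 12 * be.
(** The value of [mu] for which the gain exactly balances the bound on the terms with the factor
    [w * s] in [lyapunov_rate]. *)
Definition weight : R :=
  kappa * gain / (corr * INR (2 * n + 3) + 2 / al * (1 + 2 * (corr / al))).
Definition lyapunov (x v : R) : R :=
  - / rho x v + weight * (x * v / energy x v
                          - corr * x ^ (2 * n + 3) * v / energy x v ^ 2).
(** Each summand serves one condition of [lyapunov_rate]: [6 * b <= 1], [K * b <= al], and the lower
    bound on [rho], raised to the power [4 * n + 4] to become a bound on the energy. *)
Definition threshold : R :=
  6 * B + corr * B / al + (4 * corr * (1 + corr / al) / al ^ 3) ^ (4 * n + 4).

Lemma weight_den_pos : 0 < corr * INR (2 * n + 3) + 2 / al * (1 + 2 * (corr / al)).
Proof.
  assert (0 < corr) by (unfold corr; lra).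
  assert (0 < INR (2 * n + 3)) by (apply lt_0_INR; lia).
  assert (0 < corr / al) by (apply Rdiv_lt_0_compat; lra).
  assert (0 < 2 / al) by (apply Rdiv_lt_0_compat; lra).
  apply Rplus_lt_0_compat; apply Rmult_lt_0_compat; lra.
Qed.

Lemma weight_pos : 0 < weight.
Proof.
  apply Rdiv_lt_0_compat; [|apply weight_den_pos].
  pose proof kappa_bnd; pose proof gain_bnd. apply Rmult_lt_0_compat; lra.
Qed.

Lemma lyapunov_derive h x v t :
  0 < h -> oscillation h x v t -> threshold <= energy (x t) (v t) ->
  exists d, is_derive (fun s => lyapunov (x s) (v s)) t d /\
    h * (weight * (al / (2 * corr))) <= d.
Proof.
  intros Hh Ho HT.
  pose proof (energy_ge_1 (x t) (v t)) as HE. pose proof (rho_ge_1 (x t) (v t)) as Hr.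
  pose proof (energy_derive h x v t Ho) as dE. pose proof (rho_derive h x v t Ho) as dr.
  destruct Ho as [dx dv].
  eexists. split.
  - unfold lyapunov. replace (2 * n + 3)%nat with (S (2 * n + 2)) by lia.
    eapply (corrector_derive weight corr (2 * n + 2) x v); try eassumption; lra.
  - cbv beta. set (E := energy (x t) (v t)) in *. set (r := rho (x t) (v t)) in *.
    assert (HK : 12 <= corr) by (unfold corr; lra).
    assert (HKal : 0 < corr / al) by (apply Rdiv_lt_0_compat; lra).
    assert (HKB : 0 <= corr * B / al).
    { apply Rdiv_le_0_compat; [apply Rmult_le_pos|]; lra. }
    set (rs := 4 * corr * (1 + corr / al) / al ^ 3) in *.
    assert (Hal3 : 0 < al ^ 3) by (apply pow_lt; lra).
    assert (Hrs : 0 <= rs).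
    { apply Rdiv_le_0_compat; auto. apply Rmult_le_pos; lra. }
    assert (Hrs' : 0 <= rs ^ (4 * n + 4)) by (apply pow_le; auto).
    unfold threshold in HT. fold rs in HT.
    pose proof (g_bnd (x t)) as Hg. pose proof (G_bnd (x t)) as HG.
    pose proof (even_pow_nonneg (x t)) as Hw.
    pose proof (potential_le_energy (x t) (v t)) as HP. fold E in HP.
    pose proof kappa_bnd as Hka. pose proof gain_bnd as Hga.
    set (W := x t ^ (2 * n + 2)) in *.
    (* [INR (2 * n + 3)] is the exponent brought down by differentiating $x^{2n+3}$ in the
       corrector. *)
    pose proof (lyapunov_rate al be corr weight gain kappa (INR (2 * n + 3)) r
      (W / E) (v t ^ 2 / E) (x t * g (x t) / E) (B / E) (r * x t * v t / E)) as HL.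
    apply Rmult_le_compat_l with (r := h) in HL; try lra.
    + eapply Rle_trans; [exact HL|]. right.
      rewrite feedback_pow. fold W E r.
      replace (2 * n + 3)%nat with (S (2 * n + 2)) by lia.
      change (x t ^ S (2 * n + 2)) with (x t * W). field. lra.
    + reflexivity.
    + apply weight_pos.
    + apply pos_INR.
    + apply Rdiv_le_0_compat; lra.
    + replace (al * (W / E)) with (al * W / E) by (field; lra). apply Rle_div_l; lra.
    + apply Rdiv_le_0_compat; [apply pow2_ge_0|lra].
    + apply Rdiv_le_0_compat; lra.
    + assert (Hv2 : v t ^ 2 / E = 2 - 2 * (G (x t) / E)).
      { replace (v t ^ 2) with (2 * E - 2 * G (x t)) by (unfold E, energy; field).
        field. lra. }
      rewrite Hv2.
      assert (G (x t) / E <= B / E + be * (W / E)); [|lra].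
      replace (B / E + be * (W / E)) with ((B + be * W) / E) by (field; lra).
      apply Rmult_le_compat_r; [apply Rlt_le, Rinv_0_lt_compat; lra|lra].
    + replace (al * (W / E) - B / E) with ((al * W - B) / E) by (field; lra).
      apply Rmult_le_compat_r; [apply Rlt_le, Rinv_0_lt_compat; lra|lra].
    + replace (be * (W / E)) with (be * W / E) by (field; lra).
      apply Rmult_le_compat_r; [apply Rlt_le, Rinv_0_lt_compat; lra|lra].
    + replace (6 * (B / E)) with (6 * B / E) by (field; lra). apply Rle_div_l; lra.
    + replace (corr * (B / E)) with (al * (corr * B / al / E)) by (field; lra).
      apply Rle_trans with (al * 1); [|lra]. apply Rmult_le_compat_l; [lra|].
      apply Rle_div_l; lra.
    + apply pi_bnd.
    + apply rho_large. fold rs E. lra.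
    + right. unfold weight. pose proof weight_den_pos as Hden.
      unfold Rdiv at 1. rewrite Rmult_assoc, Rinv_l; lra.
Qed.

(** The bracket factors as $(xv/E)(1-K\,x^{2n+2}/E)$, and $al\,x^{2n+2}\le E$ bounds the second
    factor. Bounded range together with growth at a definite rate is what limits the elapsed
    time. *)
Lemma lyapunov_bnd x v :
  Rabs (lyapunov x v) <= 1 + weight * (2 / al * (1 + corr / al)).
Proof.
  pose proof (rho_ge_1 x v) as Hr. pose proof (energy_ge_1 x v) as HE.
  pose proof weight_pos as Hw.
  assert (HP : Rabs (x * v / energy x v) <= 2 / al).
  { eapply Rle_trans; [|apply (pi_bnd x v)].
    replace (rho x v * x * v / energy x v) with (rho x v * (x * v / energy x v))
      by (field; lra).
    rewrite Rabs_mult, (Rabs_right (rho x v)) by lra.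
    pose proof (Rabs_pos (x * v / energy x v)).
    assert (1 * 1 <= rho x v * rho x v) by (apply Rmult_le_compat; lra). nra. }
  assert (HW : Rabs (1 - corr * (x ^ (2 * n + 2) / energy x v)) <= 1 + corr / al).
  { pose proof (even_pow_nonneg x). pose proof (potential_le_energy x v).
    assert (0 <= x ^ (2 * n + 2) / energy x v) by (apply Rdiv_le_0_compat; lra).
    assert (x ^ (2 * n + 2) / energy x v <= / al).
    { apply Rle_div_l; [lra|]. apply Rmult_le_reg_l with al; [lra|].
      replace (al * (/ al * energy x v)) with (energy x v) by (field; lra). lra. }
    assert (corr * (x ^ (2 * n + 2) / energy x v) <= corr * / al)
      by (apply Rmult_le_compat_l; unfold corr; lra).
    assert (0 <= corr * (x ^ (2 * n + 2) / energy x v))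
      by (apply Rmult_le_pos; unfold corr; lra).
    unfold Rdiv in *. apply Rabs_le. lra. }
  unfold lyapunov.
  replace (x * v / energy x v - corr * x ^ (2 * n + 3) * v / energy x v ^ 2)
    with (x * v / energy x v * (1 - corr * (x ^ (2 * n + 2) / energy x v))).
  2: { replace (2 * n + 3)%nat with (S (2 * n + 2)) by lia.
       change (x ^ S (2 * n + 2)) with (x * x ^ (2 * n + 2)). field. lra. }
  eapply Rle_trans; [apply Rabs_triang|]. rewrite Rabs_Ropp.
  apply Rplus_le_compat.
  - rewrite Rabs_right by (apply Rle_ge, Rlt_le, Rinv_0_lt_compat; lra).
    rewrite <- Rinv_1. apply Rinv_le_contravar; lra.
  - rewrite Rabs_mult, (Rabs_right weight) by lra.
    apply Rmult_le_compat_l; [lra|]. rewrite Rabs_mult.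
    apply Rmult_le_compat; auto; apply Rabs_pos.
Qed.

(** * From the bounded Lyapunov function to blow-up *)

Lemma radius_le_energy x v M : energy x v <= M -> Rabs x + Rabs v <= M / al + 2 * M.
Proof.
  intros HM. pose proof (energy_ge_1 x v). pose proof (v_le_energy x v).
  assert (HMal : M <= M / al) by (apply Rle_div_r; nra).
  apply Rplus_le_compat.
  - apply abs_le_of_sqr; [lra|].
    apply (pow_le_inv _ _ n); [lra|]. rewrite <- pow_mult.
    replace (2 * S n)%nat with (2 * n + 2)%nat by lia.
    pose proof (potential_le_energy x v).
    apply Rle_trans with (M / al); [apply Rle_div_r; lra|].
    rewrite <- (pow_1 (M / al)) at 1. apply Rle_pow; [lra|lia].
  - apply abs_le_of_sqr; lra.
Qed.

(** Per unit of the original time [th] the bounded function [lyapunov] grows by at least a positive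
    constant, so [th] is bounded. Were the energy bounded, the orbit would stay in a ball, the
    slowdown would have a positive lower bound there, and [th] would exceed its bound. *)
Lemma escaping_flow : exists (x v th h : R -> R) (C : R),
  x 0 = 0 /\ th 0 = 0 /\
  (forall t, 0 < h t /\ is_derive th t (h t)) /\
  (forall t, 0 <= t -> oscillation (h t) x v t /\ th t <= C) /\
  (forall s t, 0 <= s <= t -> energy (x s) (v s) <= energy (x t) (v t)) /\
  (forall M, exists t, 0 <= t /\ M <= energy (x t) (v t)).
Proof.
  (* The position 0 makes the feedback vanish initially; the velocity [2 + threshold] lifts the
     initial energy above [threshold], and monotonicity of the energy keeps it there. *)
  destruct (slow_flow (fun _ v => v)
    (fun x v => - g x + feedback x v * x ^ (2 * m + 1)) 0 (2 + threshold)
    tame_snd force_tame) as (N & x & v & th & Hx0 & Hv0 & Hth0 & Hd).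
  set (h := fun t => slowdown N (x (Rabs t)) (v (Rabs t))).
  set (E := fun t => energy (x t) (v t)).
  assert (Hh : forall t, 0 < h t) by (intro; apply slowdown_pos).
  assert (Ho : forall t, 0 <= t -> oscillation (h t) x v t).
  { intros t Ht. destruct (Hd t) as (H1 & H2 & _). unfold h.
    rewrite Rabs_right in * by lra. split; assumption. }
  assert (Hmono : forall s t, 0 <= s <= t -> E s <= E t).
  { intros s t Hst. eapply derive_nonneg_le; [lra| |].
    - intros y Hy. apply (energy_derive (h y)), Ho. lra.
    - intros y _. cbv beta. pose proof (Hh y). pose proof gain_bnd.
      pose proof (rho_ge_1 (x y) (v y)). pose proof (energy_ge_1 (x y) (v y)).
      apply Rmult_le_pos; [lra|]. apply Rmult_le_pos; [apply Rmult_le_pos; lra|].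
      apply Rdiv_le_0_compat; [|lra].
      apply Rmult_le_pos; [apply even_pow_nonneg|apply pow2_ge_0]. }
  assert (HE0 : threshold <= E 0).
  { unfold E, energy. rewrite Hx0, Hv0. pose proof (proj1 (G_bnd 0)).
    assert (0 <= al * 0 ^ (2 * n + 2)) by (apply Rmult_le_pos; [lra|apply even_pow_nonneg]).
    pose proof (pow2_ge_0 (threshold + 1)). lra. }
  set (c := weight * (al / (2 * corr))).
  assert (Hc : 0 < c).
  { apply Rmult_lt_0_compat; [apply weight_pos|].
    apply Rdiv_lt_0_compat; unfold corr; lra. }
  set (V := 1 + weight * (2 / al * (1 + corr / al))).
  assert (Hth : forall t, 0 <= t -> th t <= 2 * V / c).
  { intros t Ht. apply Rle_div_r; [lra|].
    assert (lyapunov (x 0) (v 0) - c * th 0 <= lyapunov (x t) (v t) - c * th t).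
    { apply (ex_derive_nonneg_le (fun s => lyapunov (x s) (v s) - c * th s)); auto.
      intros z Hz.
      destruct (lyapunov_derive (h z) x v z) as [d [Hd1 Hd2]]; auto.
      { apply Ho; lra. }
      { apply Rle_trans with (1 := HE0). apply Hmono; lra. }
      exists (d - c * h z). fold c in Hd2. split; [|lra].
      apply (is_derive_minus (fun s => lyapunov (x s) (v s)) (fun s => c * th s)); auto.
      apply is_derive_scal. apply Hd. }
    rewrite Hth0 in H.
    pose proof (lyapunov_bnd (x t) (v t)) as B1. fold V in B1.
    pose proof (lyapunov_bnd (x 0) (v 0)) as B2. fold V in B2.
    apply Rabs_le_between in B1, B2. lra. }
  exists x, v, th, h, (2 * V / c).
  split; [auto|]. split; [auto|].
  split; [intro t; split; [apply Hh|apply Hd]|].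
  split; [auto|]. split; [exact Hmono|].
  intros M. destruct (Classical_Prop.classic (exists t, 0 <= t /\ M <= E t)) as [|Hno]; auto.
  exfalso.
  assert (HEM : forall t, 0 <= t -> E t <= M).
  { intros t Ht. destruct (Rle_dec M (E t)); [|lra]. exfalso; apply Hno; exists t; auto. }
  set (r := M / al + 2 * M).
  assert (Hr : forall t, 0 <= t -> Rabs (x t) + Rabs (v t) <= r)
    by (intros; apply radius_le_energy, HEM; auto).
  assert (Hr0 : 0 <= r) by (eapply radius_nonneg, (Hr 0); lra).
  set (q := / (1 + r) ^ N).
  assert (Hq : 0 < q) by (apply Rinv_0_lt_compat, pow_lt; lra).
  assert (HV : 0 <= V) by (eapply Rle_trans; [apply Rabs_pos|apply (lyapunov_bnd 0 0)]).
  set (t := (2 * V / c + 1) / q).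
  assert (Ht : 0 <= t).
  { apply Rdiv_le_0_compat; auto.
    assert (0 <= 2 * V / c) by (apply Rdiv_le_0_compat; lra). lra. }
  assert (q * t - q * 0 <= th t - th 0).
  { assert (th 0 - q * 0 <= th t - q * t); [|lra].
    apply (derive_nonneg_le (fun s => th s - q * s) (fun s => h s - q)); auto.
    - intros s _. apply (is_derive_minus th (fun s => q * s)); [apply Hd|].
      auto_derive; [trivial|ring].
    - intros s Hs. unfold h. rewrite Rabs_right by lra.
      pose proof (slowdown_ge N (x s) (v s) r (Hr s (proj1 Hs))) as Hq1. fold q in Hq1. lra. }
  pose proof (Hth t Ht).
  assert (q * t = 2 * V / c + 1) by (unfold t; field; lra). lra.
Qed.

Lemma oscillation_continuous_feedback (h : R) (x v : R -> R) (t : R) :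
  oscillation h x v t -> continuous (fun s => feedback (x s) (v s)) t.
Proof.
  intros Ho. pose proof (energy_ge_1 (x t) (v t)) as HE.
  assert (HE0 : 0 < energy (x t) (v t)) by lra.
  pose proof (is_derive_comp (fun y => Rpower y (kappa - 1)) _ t _ _
    (is_derive_Rpower (kappa - 1) _ HE0) (energy_derive h x v t Ho)) as HR.
  destruct Ho as [Hx Hv].
  apply (ex_derive_continuous (V := R_NormedModule)). unfold feedback.
  apply ex_derive_mult; [|eexists; exact HR].
  apply ex_derive_mult; [|eexists; exact Hv].
  apply ex_derive_mult; [apply ex_derive_const|].
  apply (ex_derive_pow x). eexists; exact Hx.
Qed.

Lemma energy_le_radius x v M :
  Rabs x + Rabs v <= M -> energy x v <= M ^ 2 / 2 + B + be * M ^ (2 * n + 2).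
Proof.
  intros HM. unfold energy. pose proof (proj2 (G_bnd x)).
  pose proof (Rabs_pos x). pose proof (Rabs_pos v).
  assert (v ^ 2 <= M ^ 2) by (rewrite <- pow2_abs; apply pow_incr; lra).
  assert (x ^ (2 * n + 2) <= M ^ (2 * n + 2)).
  { replace (2 * n + 2)%nat with (2 * (n + 1))%nat by lia.
    rewrite !(pow_mult _ 2), <- (pow2_abs x). apply pow_incr. split; [apply pow2_ge_0|].
    apply pow_incr; lra. }
  assert (be * x ^ (2 * n + 2) <= be * M ^ (2 * n + 2)) by (apply Rmult_le_compat_l; lra).
  lra.
Qed.

(** Composition with the inverse of [th], whose derivative is [/ h], restores unit speed. The energy
    is monotone, so its unboundedness becomes divergence at [T]. *)
Lemma blow_up_curve : exists (T : R) (X Y : R -> R), 0 < T /\ X 0 = 0 /\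
  (forall t, 0 <= t < T -> oscillation 1 X Y t) /\
  (forall M, exists t1, t1 < T /\
     forall t, 0 <= t -> t1 < t < T -> M <= energy (X t) (Y t)).
Proof.
  destruct escaping_flow as (x & v & th & h & C & Hx0 & Hth0 & Hth & Ho & Hmono & Hunb).
  destruct (inverse_time th h C Hth0 Hth) as (T & sg & HT & Hsg0 & Hsg).
  { intros; apply Ho; auto. }
  exists T, (fun t => x (sg t)), (fun t => v (sg t)).
  split; [rewrite <- Hth0; apply HT|]. split; [rewrite Hsg0; auto|].
  split.
  - intros t Ht. destruct (Hsg t Ht) as (Hs & _ & Hd).
    destruct (Ho _ Hs) as [[Hx Hv] _]. pose proof (proj1 (Hth (sg t))) as Hh.
    split; (evar_last; [eapply is_derive_comp; [eassumption|exact Hd]|]);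
      unfold scal; cbn -[Nat.mul Nat.add pow IZR]; unfold mult;
      cbn -[Nat.mul Nat.add pow IZR]; field; lra.
  - intros M. destruct (Hunb M) as (s & Hs & HM).
    exists (th s). split; [apply HT|]. intros t Ht0 Ht.
    destruct (Hsg t) as (Hs0 & Hinv & _); [lra|].
    apply Rle_trans with (1 := HM). apply Hmono. split; auto.
    destruct (Rle_lt_dec s (sg t)) as [|Hlt]; auto.
    apply (derive_pos_lt th h Hth) in Hlt. lra.
Qed.

Lemma profile_blow_up : exists (T : R) (q X Y : R -> R), 0 < T /\
  (forall t, continuous q t) /\ (forall t, Rabs (q t) <= 1 / 2) /\
  (forall t, t <= 0 \/ T <= t -> q t = 0) /\
  (forall t, 0 < t < T -> is_derive X t (Y t) /\
     is_derive Y t (- g (X t) + q t * X t ^ (2 * m + 1))) /\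
  (forall M, exists t1, t1 < T /\
     forall t, 0 < t -> t1 < t < T -> M < Rabs (X t) + Rabs (Y t)).
Proof.
  destruct blow_up_curve as (T & X & Y & HT & HX0 & Ho & Hinf).
  set (f := fun t => feedback (X t) (Y t)).
  assert (Hf : forall t, Rabs (f t) <= 1 / 2).
  { intros t. eapply Rle_trans; [apply feedback_bnd|].
    pose proof (rho_ge_1 (X t) (Y t)).
    replace (1 / 2) with (/ (2 * 1)) by field. apply Rinv_le_contravar; lra. }
  set (q := fun t => if Rlt_dec 0 t then if Rlt_dec t T then f t else 0 else 0).
  assert (Hq0 : forall t, t <= 0 \/ T <= t -> q t = 0).
  { intros t Ht. unfold q. destruct (Rlt_dec 0 t); auto. destruct (Rlt_dec t T); auto; lra. }
  assert (Hqf : forall t, 0 < t < T -> q t = f t).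
  { intros t Ht. unfold q. destruct (Rlt_dec 0 t); [|lra]. destruct (Rlt_dec t T); auto; lra. }
  assert (Hqle : forall t, Rabs (q t) <= Rabs (f t)).
  { intros t. destruct (Rlt_dec 0 t); [destruct (Rlt_dec t T)|].
    - rewrite Hqf; lra.
    - rewrite Hq0, Rabs_R0 by lra. apply Rabs_pos.
    - rewrite Hq0, Rabs_R0 by lra. apply Rabs_pos. }
  exists T, q, X, Y. split; [auto|]. split; [|split; [|split; [auto|split]]].
  - intros t. destruct (Rlt_dec t 0) as [H1|H1].
    + apply (continuous_ext_loc _ (fun _ => 0)); [|apply continuous_const].
      assert (Hp : 0 < - t) by lra. exists (mkposreal _ Hp). intros s Hs.
      apply Rabs_lt_between in Hs. simpl in Hs. unfold minus, plus, opp in Hs; simpl in Hs.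
      rewrite Hq0; auto; lra.
    + destruct (Rlt_dec T t) as [H2|H2].
      { apply (continuous_ext_loc _ (fun _ => 0)); [|apply continuous_const].
        assert (Hp : 0 < t - T) by lra. exists (mkposreal _ Hp). intros s Hs.
        apply Rabs_lt_between in Hs. simpl in Hs. unfold minus, plus, opp in Hs; simpl in Hs.
        rewrite Hq0; auto; lra. }
      destruct (Req_dec t T) as [->|H3].
      * apply filterlim_locally. intros eps.
        (* This energy level forces [rho] above [/ eps], hence the feedback below [eps / 2]. *)
        destruct (Hinf ((/ eps) ^ (4 * n + 4))) as (t1 & Ht1 & HM).
        assert (Hp : 0 < T - t1) by lra. exists (mkposreal _ Hp). intros s Hs.
        apply Rabs_lt_between in Hs. simpl in Hs. unfold minus, plus, opp in Hs; simpl in Hs.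
        unfold ball; simpl; unfold AbsRing_ball, abs, minus, plus, opp; simpl.
        rewrite (Hq0 T), Ropp_0, Rplus_0_r by lra.
        pose proof (cond_pos eps) as He.
        destruct (Rlt_dec 0 s); [destruct (Rlt_dec s T)|].
        -- apply Rle_lt_trans with (1 := Hqle s).
           apply Rle_lt_trans with (1 := feedback_bnd (X s) (Y s)).
           assert (/ eps <= rho (X s) (Y s)) by (apply rho_large, HM; lra).
           assert (0 < / eps) by (apply Rinv_0_lt_compat; auto).
           rewrite <- (Rinv_inv eps). apply Rinv_lt_contravar; [|lra].
           apply Rmult_lt_0_compat; lra.
        -- rewrite Hq0, Rabs_R0; lra.
        -- rewrite Hq0, Rabs_R0; lra.
      * assert (Hfc : continuous f t)
          by (apply (oscillation_continuous_feedback 1), Ho; lra).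
        destruct (Req_dec t 0) as [->|H4].
        -- assert (Hf0 : f 0 = 0).
           { unfold f, feedback. rewrite HX0, pow_i by lia. ring. }
           apply filterlim_locally. intros eps.
           assert (Hl := proj1 (filterlim_locally _ _) Hfc eps).
           revert Hl. apply filter_imp. intros s Hs. unfold ball in *; simpl in *.
           unfold AbsRing_ball, abs, minus, plus, opp in *; simpl in *.
           rewrite Hf0 in Hs. rewrite (Hq0 0) by lra.
           rewrite Ropp_0, Rplus_0_r in *. eapply Rle_lt_trans; [apply Hqle|exact Hs].
        -- apply (continuous_ext_loc _ f); auto.
           assert (Hp : 0 < Rmin t (T - t)) by (apply Rmin_pos; lra).
           exists (mkposreal _ Hp). intros s Hs.
           apply Rabs_lt_between in Hs. simpl in Hs. unfold minus, plus, opp in Hs; simpl in Hs.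
           pose proof (Rmin_l t (T - t)). pose proof (Rmin_r t (T - t)).
           rewrite Hqf; auto; lra.
  - intros t. eapply Rle_trans; [apply Hqle|apply Hf].
  - intros t Ht. rewrite (Hqf t Ht). destruct (Ho t) as [H1 H2]; [lra|].
    rewrite Rmult_1_l in H1, H2. split; assumption.
  (* On the ball of radius [M] the energy is bounded by this expression without the final 1, which
     provides the strict contradiction. *)
  - intros M. destruct (Hinf (M ^ 2 / 2 + B + be * M ^ (2 * n + 2) + 1)) as (t1 & Ht1 & HM).
    exists t1. split; auto. intros t Ht0 Ht.
    destruct (Rlt_le_dec M (Rabs (X t) + Rabs (Y t))) as [|Hle]; auto.
    apply energy_le_radius in Hle. specialize (HM t ltac:(lra) Ht). lra.
Qed.

End Oscillator.

(** * Instability of the origin and the main theorem *)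

(* Along a solution close to 0 the function [x * x'] has derivative at least
   [x^(2m+2)/4], so that it cannot stay bounded. *)
Lemma zero_unstable (n m : nat) (a p : R -> R) (be : R) :
  (m < n)%nat -> 1 <= be -> (forall x, a x <= be) -> (forall t, p t <= - (1 / 2)) ->
  ~ zero_stable (fun t x => a x * x ^ (2 * n + 1) + p t * x ^ (2 * m + 1)).
Proof.
  intros Hmn Hbe Ha Hp Hst.
  (* For $|x|<1/(4\,be)$ the term $a(x)x^{2(n-m)}$ is at most 1/4, against $-p\ge1/2$; the
     difference is the factor 1/4 in [Hlow]. *)
  assert (Heps : 0 < / (4 * be)) by (apply Rinv_0_lt_compat; lra).
  assert (Heps1 : / (4 * be) <= 1).
  { rewrite <- Rinv_1. apply Rinv_le_contravar; lra. }
  destruct (Hst 0 _ Heps) as (delta & Hdelta & H).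
  (* Released at rest, the solution has $xx'=0$ initially and $xx'\ge0$ afterwards, so $x^2$ never
     falls below its initial value. *)
  destruct (H (delta / 2) 0) as [(x & Hsol & Hx0 & Hv0) Hclose].
  { rewrite Rabs_R0, Rabs_right; lra. }
  specialize (Hclose p_infty x Hsol Hx0 Hv0).
  assert (Hsmall : forall t, 0 <= t -> Rabs (x t) + Rabs (Derive x t) < / (4 * be))
    by (intros; apply Hclose; simpl; auto).
  clear H Hclose.
  assert (Hd1 : forall t, 0 <= t -> is_derive x t (Derive x t)).
  { intros t Ht. apply Derive_correct, (Hsol t Ht I). }
  assert (Hd2 : forall t, 0 <= t -> is_derive (Derive x) t (Derive_n x 2 t)).
  { intros t Ht. apply (Derive_correct (Derive x)).
    exact (proj1 (proj2 (Hsol t Ht I))). }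
  assert (Heq : forall t, 0 <= t -> Derive_n x 2 t
    = - (a (x t) * x t ^ (2 * n + 1) + p t * x t ^ (2 * m + 1))).
  { intros t Ht. pose proof (proj2 (proj2 (Hsol t Ht I))). simpl in *. lra. }
  set (y := fun t => x t * Derive x t).
  set (dy := fun t => Derive x t * Derive x t + x t * Derive_n x 2 t).
  assert (Hdy : forall t, 0 <= t -> is_derive y t (dy t)).
  { intros t Ht. apply (is_derive_mult x (Derive x)); auto. intros; apply Rmult_comm. }
  assert (Hlow : forall t, 0 <= t -> x t ^ (2 * (m + 1)) / 4 <= dy t).
  { intros t Ht. unfold dy. rewrite Heq by auto.
    specialize (Hsmall t Ht). specialize (Ha (x t)). specialize (Hp t).
    pose proof (Rabs_pos (x t)). pose proof (Rabs_pos (Derive x t)).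
    replace (x t * - (a (x t) * x t ^ (2 * n + 1) + p t * x t ^ (2 * m + 1)))
      with (x t ^ (2 * (m + 1)) * (- p t - a (x t) * x t ^ (2 * (n - m)))).
    2: { replace (2 * n + 1)%nat with (2 * m + 1 + 2 * (n - m))%nat by lia.
         replace (2 * (m + 1))%nat with (S (2 * m + 1)) by lia.
         rewrite pow_add. simpl pow. ring. }
    assert (Hx2 : x t ^ (2 * (n - m)) <= / (4 * be)).
    { rewrite pow_mult.
      assert (x t ^ 2 <= / (4 * be)) by (rewrite <- pow2_abs; nra).
      pose proof (pow2_ge_0 (x t)).
      destruct (n - m)%nat as [|k] eqn:Hk; [lia|]. simpl.
      assert ((x t ^ 2) ^ k <= 1) by (rewrite <- (pow1 k); apply pow_incr; lra).
      assert (0 <= (x t ^ 2) ^ k) by (apply pow_le; lra).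
      simpl in *. nra. }
    pose proof (pow_even_nonneg (x t) (n - m)). pose proof (pow_even_nonneg (x t) (m + 1)).
    assert (a (x t) * x t ^ (2 * (n - m)) <= 1 / 4).
    { apply Rle_trans with (be * / (4 * be)); [|right; field; lra].
      apply Rle_trans with (be * x t ^ (2 * (n - m))).
      - apply Rmult_le_compat_r; auto.
      - apply Rmult_le_compat_l; lra. }
    pose proof (Rle_0_sqr (Derive x t)). unfold Rsqr in *.
    assert (x t ^ (2 * (m + 1)) * (1 / 4)
      <= x t ^ (2 * (m + 1)) * (- p t - a (x t) * x t ^ (2 * (n - m))))
      by (apply Rmult_le_compat_l; lra).
    lra. }
  assert (Hy0 : y 0 = 0) by (unfold y; rewrite Hv0; ring).
  assert (Hy : forall t, 0 <= t -> 0 <= y t).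
  { intros t Ht. rewrite <- Hy0. apply (derive_nonneg_le y dy); auto.
    - intros s Hs; apply Hdy; lra.
    - intros s Hs. pose proof (Hlow s (proj1 Hs)).
      pose proof (pow_even_nonneg (x s) (m + 1)). lra. }
  assert (Hx : forall t, 0 <= t -> (delta / 2) ^ 2 <= x t ^ 2).
  { intros t Ht. rewrite <- Hx0.
    apply (derive_nonneg_le (fun s => x s ^ 2) (fun s => 2 * y s)); auto.
    - intros s Hs. evar_last; [apply (is_derive_pow x 2 s _ (Hd1 s (proj1 Hs)))|].
      unfold y. simpl. ring.
    - intros s Hs. pose proof (Hy s (proj1 Hs)). lra. }
  set (c := ((delta / 2) ^ 2) ^ (m + 1) / 4).
  assert (Hc : 0 < c).
  { apply Rdiv_lt_0_compat; [|lra]. apply pow_lt, pow_lt. lra. }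
  assert (Ht : 0 <= 2 / c) by (apply Rdiv_le_0_compat; lra).
  (* By the time [2 / c] the growth rate [c] would bring [y] to at least 2, whereas closeness to the
     origin keeps [y] at most 1. *)
  assert (Hgrow : y 0 - c * 0 <= y (2 / c) - c * (2 / c)).
  { apply (derive_nonneg_le (fun s => y s - c * s) (fun s => dy s - c)); auto.
    - intros s Hs. apply (is_derive_minus y (fun s => c * s)); [apply Hdy; lra|].
      auto_derive; [trivial|ring].
    - intros s Hs. pose proof (Hlow s (proj1 Hs)) as Hl. rewrite pow_mult in Hl.
      assert (((delta / 2) ^ 2) ^ (m + 1) <= (x s ^ 2) ^ (m + 1)).
      { apply pow_incr. split; [apply pow2_ge_0|apply Hx; lra]. }
      unfold c. lra. }
  replace (c * (2 / c)) with 2 in Hgrow by (field; lra).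
  specialize (Hsmall _ Ht).
  assert (Rabs (y (2 / c)) <= 1 * 1).
  { unfold y. rewrite Rabs_mult.
    pose proof (Rabs_pos (x (2 / c))). pose proof (Rabs_pos (Derive x (2 / c))).
    apply Rmult_le_compat; lra. }
  pose proof (Rle_abs (y (2 / c))). lra.
Qed.

(** For $x^2\le1/e$ the constant dominates; otherwise $x^{2(n-m)}\ge1/e$ and the leading term does.
    This is how the lower-order force $-x^{2m+1}$ is absorbed. *)
Lemma pow_interpolation (x e : R) (m n : nat) :
  0 < e <= 1 -> (m < n)%nat ->
  x ^ (2 * m + 2) <= e * x ^ (2 * n + 2) + (/ e) ^ (m + 1).
Proof.
  intros He Hmn.
  assert (Hinv : 1 <= / e) by (rewrite <- Rinv_1; apply Rinv_le_contravar; lra).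
  replace (2 * m + 2)%nat with (2 * (m + 1))%nat by lia.
  replace (2 * n + 2)%nat with (2 * ((m + 1) + (n - m)))%nat by lia.
  rewrite !(pow_mult x 2), (pow_add _ (m + 1) (n - m)).
  pose proof (pow2_ge_0 x). set (y := x ^ 2) in *.
  assert (0 <= y ^ (m + 1)) by (apply pow_le; auto).
  assert (0 <= y ^ (n - m)) by (apply pow_le; auto).
  assert (0 < (/ e) ^ (m + 1)) by (apply pow_lt; lra).
  destruct (Rle_dec y (/ e)) as [Hle|Hgt].
  - assert (y ^ (m + 1) <= (/ e) ^ (m + 1)) by (apply pow_incr; lra).
    assert (0 <= e * (y ^ (m + 1) * y ^ (n - m)))
      by (apply Rmult_le_pos; [lra|apply Rmult_le_pos; auto]).
    lra.
  - assert (Hy : / e <= y ^ (n - m)).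
    { apply Rle_trans with (y ^ 1); [lra|]. apply Rle_pow; [lra|lia]. }
    assert (1 <= e * y ^ (n - m)).
    { apply Rmult_le_compat_l with (r := e) in Hy; [|lra]. rewrite Rinv_r in Hy; lra. }
    replace (e * (y ^ (m + 1) * y ^ (n - m))) with (y ^ (m + 1) * (e * y ^ (n - m))) by ring.
    nra.
Qed.

(** The derivative has the sign of [x]. Applied to differences between the primitive of the leading
    force and multiples of $x^{2n+2}$, it treats both half-lines at once. *)
Lemma min_at_0 (f q : R -> R) :
  (forall x, is_derive f x (x * q x)) -> (forall x, 0 <= q x) ->
  forall x, f 0 <= f x.
Proof.
  intros Hf Hq x.
  destruct (MVT_gen f 0 x (fun x => x * q x)) as [c [Hc Heq]].
  - intros; apply Hf.
  - intros; eapply is_derive_continuity_pt, Hf.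
  - assert (0 <= c * (x - 0)).
    { unfold Rmin, Rmax in Hc. destruct (Rle_dec 0 x); nra. }
    specialize (Hq c). nra.
Qed.

Lemma potential_bounds (n m : nat) (a : R -> R) (al0 be0 : R) :
  (m < n)%nat -> 0 < al0 -> (forall x, al0 <= a x <= be0) -> (forall x, continuous a x) ->
  exists (G : R -> R) (al be B : R),
    0 < al <= 1 /\ 1 <= be /\ 0 <= B /\ be0 <= be /\
    (forall x, is_derive G x (a x * x ^ (2 * n + 1) - x ^ (2 * m + 1))) /\
    (forall x, al * x ^ (2 * n + 2) - B
       <= x * (a x * x ^ (2 * n + 1) - x ^ (2 * m + 1)) <= be * x ^ (2 * n + 2)) /\
    (forall x, 1 + al * x ^ (2 * n + 2) <= G x <= B + be * x ^ (2 * n + 2)).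
Proof.
  intros Hmn Hal0 Ha Hc.
  set (A := fun x => RInt (fun s => a s * s ^ (2 * n + 1)) 0 x).
  assert (Hcont : forall s, continuous (fun s => a s * s ^ (2 * n + 1)) s).
  { intros s. apply (continuous_mult a (fun s => s ^ (2 * n + 1))); auto.
    apply (ex_derive_continuous (V := R_NormedModule)). auto_derive; trivial. }
  assert (HA : forall x, is_derive A x (a x * x ^ (2 * n + 1))).
  { intros x. apply (is_derive_RInt (fun s => a s * s ^ (2 * n + 1)) _ 0); auto.
    apply filter_forall. intros b.
    apply (RInt_correct (V := R_CompleteNormedModule)).
    apply (ex_RInt_continuous (V := R_CompleteNormedModule)). intros; apply Hcont. }
  assert (HA0 : A 0 = 0) by apply (RInt_point 0 (fun s => a s * s ^ (2 * n + 1))).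
  assert (Hpow : forall (k : nat) (x : R),
    is_derive (fun x => x ^ (2 * k + 2) / INR (2 * k + 2)) x (x ^ (2 * k + 1))).
  { intros k x. replace (2 * k + 2)%nat with (S (2 * k + 1)) by lia.
    pose proof (not_0_INR (S (2 * k + 1)) ltac:(lia)) as H0.
    generalize dependent (2 * k + 1)%nat. intros p H0.
    auto_derive; [trivial|].
    change (match p with O => 1 | S _ => INR p + 1 end) with (INR (S p)).
    field. exact H0. }
  set (c := INR (2 * n + 2)).
  assert (Hc1 : 1 <= c) by (apply (le_INR 1); lia).
  assert (Hz : 0 ^ (2 * n + 2) = 0) by (apply pow_i; lia).
  assert (Hsplit : forall x, x ^ (2 * n + 1) = x * x ^ (2 * n)).
  { intros x. replace (2 * n + 1)%nat with (S (2 * n)) by lia. reflexivity. }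
  assert (HAlo : forall x, al0 * (x ^ (2 * n + 2) / c) <= A x).
  { intros x.
    pose proof (min_at_0 (fun x => A x - al0 * (x ^ (2 * n + 2) / c))
      (fun x => (a x - al0) * x ^ (2 * n))) as H.
    cbv beta in H. rewrite HA0, Hz in H.
    assert (0 - al0 * (0 / c) <= A x - al0 * (x ^ (2 * n + 2) / c)); [|lra].
    apply H.
    - intros z. evar_last.
      + apply (is_derive_minus A (fun x => al0 * (x ^ (2 * n + 2) / c))); [apply HA|].
        apply is_derive_scal, Hpow.
      + unfold minus, plus, opp; cbn -[Nat.mul Nat.add pow]. rewrite Hsplit. ring.
    - intros z. specialize (Ha z). apply Rmult_le_pos; [lra|apply pow_even_nonneg]. }
  assert (HAhi : forall x, A x <= be0 * (x ^ (2 * n + 2) / c)).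
  { intros x.
    pose proof (min_at_0 (fun x => be0 * (x ^ (2 * n + 2) / c) - A x)
      (fun x => (be0 - a x) * x ^ (2 * n))) as H.
    cbv beta in H. rewrite HA0, Hz in H.
    assert (be0 * (0 / c) - 0 <= be0 * (x ^ (2 * n + 2) / c) - A x); [|lra].
    apply H.
    - intros z. evar_last.
      + apply (is_derive_minus (fun x => be0 * (x ^ (2 * n + 2) / c)) A); [|apply HA].
        apply is_derive_scal, Hpow.
      + unfold minus, plus, opp; cbn -[Nat.mul Nat.add pow]. rewrite Hsplit. ring.
    - intros z. specialize (Ha z). apply Rmult_le_pos; [lra|apply pow_even_nonneg]. }
  (* At most half of the coefficient [al0 / c] of the primitive is kept; the other half absorbs
     $x^{2m+2}$ by interpolation. *)
  set (al := Rmin 1 (al0 / (2 * c))).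
  assert (Hal : 0 < al) by (apply Rmin_pos; [lra|apply Rdiv_lt_0_compat; lra]).
  assert (Hal1 : al <= 1) by apply Rmin_l.
  assert (Hal2 : 2 * al <= al0 / c).
  { replace (al0 / c) with (2 * (al0 / (2 * c))) by (field; lra).
    pose proof (Rmin_r 1 (al0 / (2 * c))). unfold al. lra. }
  assert (Hal3 : al0 / c <= al0) by (apply Rle_div_l; nra).
  set (C := (/ al) ^ (m + 1)).
  assert (HC : 0 < C) by (apply pow_lt, Rinv_0_lt_compat; auto).
  assert (Hint : forall x, x ^ (2 * m + 2) <= al * x ^ (2 * n + 2) + C)
    by (intros; apply pow_interpolation; auto).
  assert (Heven : forall k x, 0 <= x ^ (2 * k + 2)).
  { intros k x. replace (2 * k + 2)%nat with (2 * (k + 1))%nat by lia.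
    apply pow_even_nonneg. }
  assert (Hbe0 : 0 < be0) by (specialize (Ha 0); lra).
  (* [C] offsets the interpolation constant and the extra 1 normalises the potential; [1 + be0]
     secures [1 <= be] while still bounding [a]. *)
  exists (fun x => 1 + C + A x - x ^ (2 * m + 2) / INR (2 * m + 2)), al, (1 + be0), (1 + C).
  do 4 (split; [lra|]). split; [|split]; intros x; [|split|split].
  - apply (is_derive_minus (fun x => 1 + C + A x)
      (fun x => x ^ (2 * m + 2) / INR (2 * m + 2))); [|apply Hpow].
    rewrite <- (Rplus_0_l (a x * _)). apply (is_derive_plus (fun _ => 1 + C)); auto.
    apply (is_derive_const (1 + C)).
  - replace (x * (a x * x ^ (2 * n + 1) - x ^ (2 * m + 1)))
      with (a x * x ^ (2 * n + 2) - x ^ (2 * m + 2))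
      by (replace (2 * n + 2)%nat with (S (2 * n + 1)) by lia;
          replace (2 * m + 2)%nat with (S (2 * m + 1)) by lia; simpl pow; ring).
    specialize (Ha x). specialize (Hint x). pose proof (Heven n x).
    assert (2 * al * x ^ (2 * n + 2) <= a x * x ^ (2 * n + 2))
      by (apply Rmult_le_compat_r; lra).
    lra.
  - replace (x * (a x * x ^ (2 * n + 1) - x ^ (2 * m + 1)))
      with (a x * x ^ (2 * n + 2) - x ^ (2 * m + 2))
      by (replace (2 * n + 2)%nat with (S (2 * n + 1)) by lia;
          replace (2 * m + 2)%nat with (S (2 * m + 1)) by lia; simpl pow; ring).
    specialize (Ha x). pose proof (Heven n x). pose proof (Heven m x).
    assert (a x * x ^ (2 * n + 2) <= (1 + be0) * x ^ (2 * n + 2))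
      by (apply Rmult_le_compat_r; lra).
    lra.
  - specialize (Hint x). specialize (HAlo x). pose proof (Heven n x). pose proof (Heven m x).
    assert (Hm1 : 1 <= INR (2 * m + 2)) by (apply (le_INR 1); lia).
    assert (x ^ (2 * m + 2) / INR (2 * m + 2) <= x ^ (2 * m + 2)).
    { apply Rle_div_l; [lra|]. nra. }
    assert (2 * al * x ^ (2 * n + 2) <= al0 / c * x ^ (2 * n + 2))
      by (apply Rmult_le_compat_r; lra).
    unfold Rdiv in *. lra.
  - specialize (HAhi x). pose proof (Heven n x). pose proof (Heven m x).
    assert (Hm1 : 1 <= INR (2 * m + 2)) by (apply (le_INR 1); lia).
    assert (0 <= x ^ (2 * m + 2) / INR (2 * m + 2)) by (apply Rdiv_le_0_compat; lra).
    assert (x ^ (2 * n + 2) / c <= x ^ (2 * n + 2)).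
    { apply Rle_div_l; [lra|]. nra. }
    assert (be0 * (x ^ (2 * n + 2) / c) <= be0 * x ^ (2 * n + 2))
      by (apply Rmult_le_compat_l; lra).
    lra.
Qed.

(** * Regularity of the periodic coefficient, and the theorem *)

Lemma periodic_Derive (f : R -> R) (P : R) :
  (forall x, f (x + P) = f x) -> forall x, Derive f (x + P) = Derive f x.
Proof.
  intros Hf x. unfold Derive. f_equal. apply Lim_ext. intros h.
  replace (x + P + h) with (x + h + P) by ring. rewrite !Hf. reflexivity.
Qed.

Lemma smooth_periodic_lipschitz (f : R -> R) :
  smooth f -> periodic f ->
  exists M, 0 <= M /\ (forall x, Rabs (f x) <= M) /\
    (forall x y, Rabs (f y - f x) <= M * Rabs (y - x)).
Proof.
  intros Hs Hp.
  assert (Hd : forall x, is_derive f x (Derive f x)).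
  { intros x. apply Derive_correct, (Hs 1%nat). }
  assert (Hc : forall x, continuous f x) by (intro; eapply is_derive_continuous, Hd).
  assert (Hc' : forall x, continuous (Derive f) x).
  { intros x. apply (ex_derive_continuous (V := R_NormedModule)), (Hs 2%nat). }
  destruct (periodic_extremum f Hp Hc) as (l & u & H1).
  assert (Hp' : periodic (Derive f)).
  { destruct Hp as (P & HP & Hf). exists P. split; auto. apply periodic_Derive; auto. }
  destruct (periodic_extremum _ Hp' Hc') as (l' & u' & H2).
  pose proof (Rabs_pos (f l)); pose proof (Rabs_pos (f u)).
  pose proof (Rabs_pos (Derive f l')); pose proof (Rabs_pos (Derive f u')).
  assert (Hbnd : forall y a b, a <= y <= b -> Rabs y <= Rabs a + Rabs b).
  { intros y a b Hy. pose proof (Rle_abs b). pose proof (Rle_abs (- a)) as Ha.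
    rewrite Rabs_Ropp in Ha. pose proof (Rabs_pos a). pose proof (Rabs_pos b).
    apply Rabs_le. lra. }
  exists (Rabs (f l) + Rabs (f u) + (Rabs (Derive f l') + Rabs (Derive f u'))).
  split; [lra|]. split.
  - intros x. pose proof (Hbnd _ _ _ (H1 x)). lra.
  - intros x y. destruct (MVT_gen f x y (Derive f)) as [c [_ ->]].
    + intros; apply Hd.
    + intros; eapply is_derive_continuity_pt, Hd.
    + rewrite Rabs_mult. apply Rmult_le_compat_r; [apply Rabs_pos|].
      pose proof (Hbnd _ _ _ (H2 c)). lra.
Qed.

Lemma restoring_force_tame (n m : nat) (a : R -> R) :
  smooth a -> periodic a ->
  tame (fun x _ => a x * x ^ (2 * n + 1) - x ^ (2 * m + 1)).
Proof.
  intros Hs Hp. destruct (smooth_periodic_lipschitz a Hs Hp) as (M & HM & Hb & Hl).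
  apply (tame_plus (fun x _ => a x * x ^ (2 * n + 1)) (fun x _ => - x ^ (2 * m + 1))).
  - apply (tame_mult (fun x _ => a x) (fun x _ => x ^ (2 * n + 1))).
    + apply (tame_comp a (fun _ => True) M (fun x _ => x)); auto. apply tame_fst.
    + apply (tame_pow (fun x _ => x)), tame_fst.
  - apply (tame_opp (fun x _ => x ^ (2 * m + 1))).
    apply (tame_pow (fun x _ => x)), tame_fst.
Qed.

(** The derivatives in [solution_on] are two-sided and the equation is known only inside (0, T),
    hence the interior starting time [T / 2]. *)
Lemma curve_blows_up (F : R -> R -> R) (T : R) (X Y : R -> R) :
  0 < T ->
  (forall t, 0 < t < T -> is_derive X t (Y t) /\ is_derive Y t (- F t (X t))) ->
  (forall M, exists t1, t1 < T /\
     forall t, 0 < t -> t1 < t < T -> M < Rabs (X t) + Rabs (Y t)) ->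
  blows_up F (T / 2) T X.
Proof.
  intros HT Hd Hinf.
  assert (HD : forall t, 0 < t < T -> Derive X t = Y t)
    by (intros; apply is_derive_unique, Hd; auto).
  split; [lra|]. split.
  - intros t Ht1 Ht2. simpl in Ht2. assert (Ht : 0 < t < T) by lra.
    destruct (Hd t Ht) as [H1 H2].
    assert (H3 : is_derive (Derive X) t (- F t (X t))).
    { apply (is_derive_ext_loc Y); auto.
      assert (Hp : 0 < Rmin t (T - t)) by (apply Rmin_pos; lra).
      exists (mkposreal _ Hp). intros s Hs.
      apply Rabs_lt_between in Hs. simpl in Hs. unfold minus, plus, opp in Hs; simpl in Hs.
      pose proof (Rmin_l t (T - t)). pose proof (Rmin_r t (T - t)).
      symmetry. apply HD. lra. }
    split; [exists (Y t); auto|]. split; [exists (- F t (X t)); auto|].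
    change (Derive_n X 2 t) with (Derive (Derive X) t).
    rewrite (is_derive_unique _ _ _ H3). ring.
  - intros P [M HP]. destruct (Hinf M) as (t1 & Ht1 & HM).
    assert (Hp : 0 < Rmin T (T - t1)) by (apply Rmin_pos; lra).
    exists (mkposreal _ Hp). intros s Hs HsT.
    apply Rabs_lt_between in Hs. simpl in Hs. unfold minus, plus, opp in Hs; simpl in Hs.
    pose proof (Rmin_l T (T - t1)). pose proof (Rmin_r T (T - t1)).
    apply HP. rewrite HD by lra. apply HM; lra.
Qed.

Theorem theorem1p2 (n m : nat) (a : R -> R)
  (hn : (0 < n)%nat) (hm : (0 < m)%nat)
  (hnm : (n + 2 <= 2 * m + 1)%nat) (hmn : (2 * m + 1 < 2 * n + 1)%nat)
  (ha_pos : forall x : R, 0 < a x) (ha_smooth : smooth a)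
  (ha_per : periodic a) :
  exists p : R -> R,
    (forall t : R, continuous p t) /\ (forall t : R, p t <= 0) /\ periodic p /\
    (exists (t0 T : R) (x : R -> R),
       blows_up (fun t x => a x * x ^ (2 * n + 1) + p t * x ^ (2 * m + 1))
         t0 T x) /\
    ~ zero_stable (fun t x => a x * x ^ (2 * n + 1) + p t * x ^ (2 * m + 1)).
Proof.
  assert (Hc : forall x, continuous a x).
  { intros x. apply (ex_derive_continuous (V := R_NormedModule)), (ha_smooth 1%nat). }
  destruct (periodic_extremum a ha_per Hc) as (l & u & Hlu).
  destruct (potential_bounds n m a (a l) (a u)) as
    (G & al & be & B & Hal & Hbe & HB & Hube & HG & Hg & HGb); auto; [lia|].
  destruct (profile_blow_up n m (fun x => a x * x ^ (2 * n + 1) - x ^ (2 * m + 1)) G al be B)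
    as (T & q & X & Y & HT & Hqc & Hqb & Hq0 & HXY & Hinf); auto; try lia.
  { apply restoring_force_tame; auto. }
  assert (Hp : forall t, - 1 - q (wrap T t) <= - (1 / 2)).
  { intros t. specialize (Hqb (wrap T t)). apply Rabs_le_between in Hqb. lra. }
  (* The summand -1 is already contained in the restoring force as $-x^{2m+1}$, so only [q] is made
     periodic; on [0, T) [wrap T] is the identity and the equation is that of the profile. *)
  exists (fun t => - 1 - q (wrap T t)). split; [|split; [|split; [|split]]].
  - intros t. apply (continuous_minus (fun _ => - 1) (fun t => q (wrap T t))).
    + apply continuous_const.
    + apply continuous_wrap; auto.
  - intros t. specialize (Hp t). lra.
  - exists T. split; auto. intros t. rewrite wrap_periodic; auto.
  - exists (T / 2), T, X. apply (curve_blows_up _ T X Y); auto.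
    intros t Ht. destruct (HXY t Ht) as [H1 H2]. split; auto.
    rewrite wrap_id by lra. evar_last; [exact H2|]. ring.
  - apply (zero_unstable n m a _ be); auto; [lia|].
    intros x. specialize (Hlu x). lra.
Qed.
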